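(* Let $X$ be a Banach space as described in the context, assume $\mu_1:=\liminf_{n\to\infty}\|z^n\|^{1/n}>0$ and $\mu_2:=\limsup_{n\to\infty}\|z^n\|^{1/n}<\infty$, and let $f\in X$. If $f$ is (the restriction to $\mathbb{D}$ of) an entire function of finite order $\rho\in(0,\infty)$, then $$\limsup_{n\to\infty}\frac{n\ln n}{\ln\frac{\|z^n\|}{E_n(f)}}=\rho .$$ Conversely, if this equality holds for some $\rho\in(0,\infty)$, then the sequence $(p_n^* )$ of polynomials of best approximation of $f$ in the norm of $X$ converges uniformly in each disk $|z|<r$, $r\in(0,\mu_1)$, to some entire function of finite order $\rho$.
   Context: $\mathbb{D}=\{z\in\mathbb{C}:|z|<1\}$. Here $X$ is a complex Banach space of functions defined in $\mathbb{D}$ (not necessarily analytic) whose norm $\|\cdot\|$ satisfies: (i) $\|f(\cdot\, e^{it})\|=\|f(\cdot)\|$ for all $t\in\mathbb{R}$ and $f\in X$; (ii) $\|f\|<\infty$ for every entire function $f$; (iii) for all $f\in X$ and $g\in L[0,2\pi]$, $\big\|\frac{1}{2\pi}\int_0^{2\pi} f(ze^{it})g(t)\,dt\big\|\le \frac{1}{2\pi}\int_0^{2\pi}|g(t)|\,dt\cdot\|f\|$. For $n\ge 1$, $\mathcal{P}_n$ is the set of complex polynomials of degree at most $n-1$, $E_n(f)=\inf_{p\in\mathcal{P}_n}\|f-p\|$, $p_n^*\in\mathcal{P}_n$ is a polynomial with $\|f-p_n^*\|=E_n(f)$, and $\|z^n\|$ is the norm in $X$ of $z\mapsto z^n$. The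 order of an entire function $F$ is $\limsup_{r\to\infty}\frac{\ln\ln M(r)}{\ln r}$, $M(r)=\max_{|z|=r}|F(z)|$. *)

(* Defs.v *)
From HB Require Import structures.
From mathcomp Require Import all_boot all_order all_algebra.
From mathcomp Require Import all_classical all_reals all_analysis.
From mathcomp Require Import complex.
Import Order.TTheory GRing.Theory Num.Theory.
Import numFieldNormedType.Exports.

Set Implicit Arguments.
Unset Strict Implicit.
Unset Printing Implicit Defensive.

Local Open Scope classical_set_scope.
Local Open Scope ring_scope.
Local Open Scope complex_scope.

Section Defs.
Variable R : realType.
Local Notation C := R[i].

Definition cabs (z : C) : R := ComplexField.Normc.normc z.

Definition expi (t : R) : C := (cos t) +i* (sin t).

Definition diskD : set C := [set z | cabs z < 1].

Definition eqD (f g : C -> C) : Prop := forall z, diskD z -> f z = g z.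

Definition entire (F : C -> C) : Prop :=
  forall z : C, derivable (F : C^o -> C^o) z 1.

Definition maxmod (F : C -> C) (r : R) : R :=
  sup [set cabs (F z) | z in [set z : C | cabs z = r]].

Definition entire_order (F : C -> C) : \bar R :=
  limf_esup (fun r : R => ((ln (ln (maxmod F r)) / ln r)%:E)) (pinfty_nbhs R).

Definition I02pi : set R := `[0, pi *+ 2]%classic.

Definition cint (g : R -> C) : C :=
  (Rintegral lebesgue_measure I02pi (fun t => complex.Re (g t)))
  +i* (Rintegral lebesgue_measure I02pi (fun t => complex.Im (g t))).

Definition L1_02pi (g : R -> C) : Prop :=
  lebesgue_measure.-integrable I02pi (fun t => (complex.Re (g t))%:E) /\
  lebesgue_measure.-integrable I02pi (fun t => (complex.Im (g t))%:E).

(* The standing assumptions on the space X.  X is represented as a set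
   inX of functions C -> C (only their values on D matter) together with
   the norm nrm (only meaningful on inX). *)
Definition fun_Banach_space (inX : set (C -> C)) (nrm : (C -> C) -> R) : Prop :=
  [/\
    (forall f g, eqD f g -> inX f -> inX g /\ nrm g = nrm f),
    inX (fun=> 0) /\
    (forall (a : C) f g, inX f -> inX g -> inX (fun z => a * f z + g z)),
    (forall f, inX f -> 0 <= nrm f /\ (nrm f = 0 <-> eqD f (fun=> 0))) /\
    (forall (a : C) f, inX f -> nrm (fun z => a * f z) = cabs a * nrm f) /\
    (forall f g, inX f -> inX g -> nrm (fun z => f z + g z) <= nrm f + nrm g),
    (forall u : nat -> C -> C, (forall n, inX (u n)) ->
       (forall eps : R, 0 < eps -> exists N : nat, forall m n : nat,
          (N <= m)%N -> (N <= n)%N -> nrm (fun z => u m z - u n z) < eps) ->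
       exists f, inX f /\ (forall eps : R, 0 < eps -> exists N : nat,
          forall n : nat, (N <= n)%N -> nrm (fun z => u n z - f z) < eps))
  &
    [/\ (forall f (t : R), inX f ->
          inX (fun z => f (z * expi t)) /\ nrm (fun z => f (z * expi t)) = nrm f),
        (forall F, entire F -> inX F)
    &
        (forall f g, inX f -> L1_02pi g ->
          let F := fun z => ((pi *+ 2)^-1)%:C * cint (fun t => f (z * expi t) * g t) in
          inX F /\
          nrm F <= (pi *+ 2)^-1 * Rintegral lebesgue_measure I02pi (fun t => cabs (g t)) * nrm f)]].

Definition polyf (p : {poly C}) : C -> C := fun z => p.[z].

Definition En (nrm : (C -> C) -> R) (f : C -> C) (n : nat) : R :=
  inf [set nrm (fun z => f z - p.[z]) | p in [set p : {poly C} | (size p <= n)%N]].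

Definition normzn (nrm : (C -> C) -> R) (n : nat) : R := nrm (fun z : C => z ^+ n).

End Defs.

(* Main.v *)
Require Import Defs.
From HB Require Import structures.
From mathcomp Require Import all_boot all_order all_algebra.
From mathcomp Require Import all_classical all_reals all_analysis.
From mathcomp Require Import complex ring lra.
Import Order.TTheory GRing.Theory Num.Theory.
Import numFieldNormedType.Exports.
Local Open Scope classical_set_scope.
Local Open Scope ring_scope.
Local Open Scope complex_scope.

(* Both implications compare three decay/growth conditions, for s close to rho:
     M(r) <= exp(r^s),   |c_n| <= C^n n^(-n/s),   E_n <= ||z^n|| n^(-n/s),
   where the c_n are the Taylor coefficients of F.  Cauchy's estimate at
   r = n^(1/s) and the maximum of (r n^(-1/s))^n over n exchange the first two;
   |c_n| ||z^n|| <= E_n <= sum_(k >= n) |c_k| ||z^k|| exchanges the last two.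
   The lower bound is (iii) with g(t) = e^(-int).  For the upper bound one must
   know that the Taylor series converges to F in the norm of X: this is (iii)
   applied to F(2z) and g(t) = u^n/(1 - u), u = e^(-it)/2, since by Cauchy's
   formula on the circle of radius 2|z| the corresponding integral is the n-th
   Taylor remainder of F at z.  The same argument shows, in the converse, that
   the limit of the p_n^* is f on the disk.
   Cauchy's formula is derived from complex differentiability alone: Goursat's
   lemma for Phi(e^(s+it)) on rectangles of height 2 pi, where the horizontal
   sides cancel by periodicity, makes the mean of Phi over circles about 0
   independent of the radius, even if differentiability fails on |z| = 1. *)

Set Implicit Arguments.
Unset Strict Implicit.
Unset Printing Implicit Defensive.

Local Notation Re := (@complex.Re _).
Local Notation Im := (@complex.Im _).

(** * Modulus and continuity *)

Section Modulus.
Variable R : realType.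
Local Notation C := R[i].
Implicit Types (x y z w : C) (t : R).

(** The norm of [X] is not assumed to control point values, so [X] and pointwise analysis
    communicate only through (iii), whose kernels depend on [t] alone. On the circle |w| = 2|z| the
    ratio z/w in Cauchy's formula is e^(-it)/2, free of z: this is why the radius is 2|z| and why
    remainders have norms of order 2^-n. The price is the norm of F(2z), finite by (ii). For the
    same reason the limit in the converse is built from coefficients weighted by ||z^k|| and
    compared with f afterwards. The conditions on mu_1 and mu_2 enclose ||z^n|| between m1^n and
    m2^n for large n. Replacing s by s' > s gains n^(n(1/s - 1/s')), which beats every C^n; hence
    constants may be crude, and the loss in the exponent vanishes as s and s' tend to rho. The bound
    r < mu_1 enters once more at the end: it makes r^k/||z^k|| bounded, which turns weighted bounds
    on coefficients into uniform convergence. *)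

Lemma normcE z : `|z| = (cabs z)%:C.
Proof. by case: z => a b; rewrite normc_def. Qed.

Lemma cabs0 : cabs (0 : C) = 0.
Proof. exact: ComplexField.Normc.normc0. Qed.

Lemma cabs1 : cabs (1 : C) = 1.
Proof. exact: ComplexField.Normc.normc1. Qed.

Lemma cabsM z w : cabs (z * w) = cabs z * cabs w.
Proof. exact: ComplexField.Normc.normcM. Qed.

Lemma cabsV z : cabs z^-1 = (cabs z)^-1.
Proof. exact: ComplexField.Normc.normcV. Qed.

Lemma cabsX z n : cabs (z ^+ n) = cabs z ^+ n.
Proof. by elim: n => [|n IHn]; rewrite ?cabs1// !exprS cabsM IHn. Qed.

Lemma cabsN z : cabs (- z) = cabs z.
Proof. by case: z => a b; rewrite /cabs /= !sqrrN. Qed.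

Lemma cabs_ge0 z : 0 <= cabs z.
Proof. by case: z => a b; rewrite /cabs /= sqrtr_ge0. Qed.

Lemma cabs_eq0 z : (cabs z == 0) = (z == 0).
Proof.
apply/eqP/eqP => [|->]; last exact: cabs0.
exact: ComplexField.Normc.eq0_normc.
Qed.

Lemma cabs_gt0 z : (0 < cabs z) = (z != 0).
Proof. by rewrite lt_def cabs_eq0 cabs_ge0 andbT. Qed.

Lemma cabsD z w : cabs (z + w) <= cabs z + cabs w.
Proof. by rewrite -lecR rmorphD /= -!normcE ler_normD. Qed.

Lemma cabsB z w : cabs (z - w) <= cabs z + cabs w.
Proof. by rewrite (le_trans (cabsD _ _))// cabsN. Qed.

Lemma cabs_distC z w : cabs (z - w) = cabs (w - z).
Proof. by rewrite -cabsN opprB. Qed.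

Lemma cabs_lebD z w : cabs z - cabs w <= cabs (z - w).
Proof. by rewrite lerBlDr (le_trans _ (cabsD _ _))// subrK. Qed.

Lemma cabs_sum (I : Type) (r : seq I) (P : pred I) (g : I -> C) :
  cabs (\sum_(i <- r | P i) g i) <= \sum_(i <- r | P i) cabs (g i).
Proof.
elim/big_rec2 : _ => [|i y x _ h]; first by rewrite cabs0.
by rewrite (le_trans (cabsD _ _))// lerD2l.
Qed.

Lemma ler_Re_cabs z : `|Re z| <= cabs z.
Proof.
case: z => a b; rewrite /cabs /= -sqrtr_sqr ler_sqrt ?lerDl ?sqr_ge0//.
by rewrite addr_ge0 ?sqr_ge0.
Qed.

Lemma ler_Im_cabs z : `|Im z| <= cabs z.
Proof.
case: z => a b; rewrite /cabs /= -sqrtr_sqr ler_sqrt ?lerDr ?sqr_ge0//.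
by rewrite addr_ge0 ?sqr_ge0.
Qed.

Lemma cabs_real t : cabs t%:C = `|t|.
Proof. by rewrite /cabs /= expr0n addr0 sqrtr_sqr. Qed.

Lemma cabs_i : cabs ('i : C) = 1.
Proof. by rewrite /cabs /= expr0n add0r expr1n sqrtr1. Qed.

Lemma cabs_le_ReIm z : cabs z <= `|Re z| + `|Im z|.
Proof.
rewrite [in X in cabs X](complexE z) (le_trans (cabsD _ _))//.
by rewrite cabsM cabs_i mul1r !cabs_real.
Qed.

Lemma cabs_expi t : cabs (expi t) = 1.
Proof. by rewrite /cabs /= cos2Dsin2 sqrtr1. Qed.

Lemma expiD s t : expi (s + t) = expi s * expi t :> C.
Proof.
rewrite /expi cosD sinD; apply/eqP; rewrite eq_complex /=.
by rewrite eqxx /= addrC.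
Qed.

Lemma expi0 : expi 0 = 1 :> C.
Proof. by rewrite /expi cos0 sin0. Qed.

Lemma expi2pi t : expi (t + pi *+ 2) = expi t :> C.
Proof. by rewrite /expi cosD2pi sinD2pi. Qed.

Lemma expi_neq0 t : expi t != 0 :> C.
Proof. by rewrite -cabs_gt0 cabs_expi. Qed.

Lemma polar z : exists t, z = (cabs z)%:C * expi t.
Proof.
have [->|z0] := eqVneq z 0; first by exists 0; rewrite cabs0 mul0r.
have c0 : 0 < cabs z by rewrite cabs_gt0.
pose w := z / (cabs z)%:C.
have zw : z = (cabs z)%:C * w.
  by rewrite mulrC divfK// (inj_eq (@complexI _)) gt_eqF.
have w1 : cabs w = 1.
  by rewrite /w cabsM cabsV cabs_real ger0_norm ?cabs_ge0// divff// gt_eqF.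
suff [t wt] : exists t, w = expi t by exists t; rewrite -wt.
clearbody w; clear -w1; case: w w1 => a b; rewrite /cabs /= => ab.
have {}ab : a ^+ 2 + b ^+ 2 = 1.
  rewrite -(sqr_sqrtr (addr_ge0 (sqr_ge0 a) (sqr_ge0 b))).
  by rewrite ab expr1n.
have a1 : -1 <= a <= 1.
  by have b2 := sqr_ge0 b; apply/andP; split; nra.
have sa : sin (acos a) = `|b|.
  rewrite sin_acos// -sqrtr_sqr; congr Num.sqrt.
  by rewrite -ab addrC addKr.
case: (leP 0 b) => b0.
  by exists (acos a); rewrite /expi acosK// sa ger0_norm.
exists (- acos a); rewrite /expi cosN sinN acosK// sa ltr0_norm//.
by rewrite opprK.
Qed.

End Modulus.

Section DerivableEps.

(** Stated over any [numFieldType] to serve both the real functions [expR], [cos], [sin] and complex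
    derivatives. Clearing the denominator of the difference quotient admits [h = 0]. *)
Lemma derivable_norm (K : numFieldType) (f : K^o -> K^o) (z : K^o) (e : K) :
  derivable f z 1 -> 0 < e -> exists2 d : K, 0 < d & forall h : K, `|h| < d ->
      `|f (z + h) - f z - 'D_1 f z * h| <= e * `|h|.
Proof.
move=> df e0.
have /cvgrPdist_le /(_ e e0) : h^-1 *: (f (h *: 1 + z) - f z) @[h --> 0^'] --> 'D_1 f z.
  exact: df.
move=> /nbhs_ballP[d /= d0 hd]; exists d => // h hd'.
have [->|h0] := eqVneq h 0; first by rewrite addr0 subrr mulr0 subr0 normr0 mulr0.
have := hd h; rewrite -ball_normE /ball_ /= sub0r normrN => /(_ hd' h0).
rewrite -(ler_pM2r (x := `|h|)) ?normr_gt0//; apply: le_trans.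
rewrite -normrM distrC /GRing.scale /= mulr1 (addrC h).
by rewrite mulrBl [_^-1 * _]mulrC divfK.
Qed.

Lemma derivable_normP (K : numFieldType) (f : K^o -> K^o) (z : K^o) :
  derivable f z 1 <-> exists A : K, forall e : K, 0 < e ->
    exists2 d : K, 0 < d & forall h : K, `|h| < d ->
      `|f (z + h) - f z - A * h| <= e * `|h|.
Proof.
split=> [df|[A hA]]; first by exists ('D_1 f z) => e; exact: derivable_norm.
apply/cvg_ex; exists A; apply/cvgrPdist_le => e e0.
have [d d0 hd] := hA e e0; apply/nbhs_ballP; exists d => //= h.
rewrite -ball_normE /ball_ /= sub0r normrN => hd' h0.
  rewrite -(ler_pM2r (x := `|h|)) ?normr_gt0//; apply: le_trans (hd h hd').
  rewrite -normrM distrC /GRing.scale /= mulr1 (addrC h).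
  by rewrite mulrBl [_^-1 * _]mulrC divfK.
Qed.

End DerivableEps.

Section ComplexContinuity.
Variable R : realType.
Local Notation C := R[i].

Definition cderivable_at (F : C -> C) z := derivable (F : C^o -> C^o) z 1.

Lemma cderivableP (F : C -> C) z :
  cderivable_at F z <-> exists A : C, forall e : R, 0 < e ->
    exists2 d : R, 0 < d & forall h : C, cabs h < d ->
      cabs (F (z + h) - F z - A * h) <= e * cabs h.
Proof.
split=> [/derivable_normP[A hA]|[A hA]].
(* A positive element of [R[i]] has zero imaginary part, so the complex tolerances of
   [derivable_normP] are real numbers. *)
- exists A => e e0; have := hA e%:C; rewrite ltcR => /(_ e0)[[d d'] /=].
  rewrite ltcE /= => /andP[/eqP -> d0] hd; exists d => // h hd'.
  by have := hd h; rewrite !normcE ltcR -(rmorphM (real_complex R)) lecR; apply.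
- apply/derivable_normP; exists A => -[e e'] /=; rewrite ltcE /= => /andP[/eqP -> e0].
  have [d d0 hd] := hA e e0; exists d%:C; rewrite ?ltcR// => h.
  by rewrite !normcE ltcR -(rmorphM (real_complex R)) lecR; exact: hd.
Qed.

Definition ccontinuous_at (F : C -> C) z := forall e : R, 0 < e ->
  exists2 d : R, 0 < d & forall w, cabs (w - z) < d -> cabs (F w - F z) < e.

Lemma cderivable_continuous F z : cderivable_at F z -> ccontinuous_at F z.
Proof.
move=> /cderivableP[A hA] e e0; have [d d0 hd] := hA 1 ltr01.
have B0 : 0 < 1 + cabs A by rewrite ltr_pwDl ?cabs_ge0.
exists (Num.min d (e / (1 + cabs A))); first by rewrite lt_min d0 divr_gt0.
move=> w; rewrite lt_min ltr_pdivlMr// => /andP[wd we].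
have := hd (w - z) wd; rewrite mul1r (addrC z) subrK => h1.
apply: le_lt_trans we; rewrite -(subrK (A * (w - z)) (F w - F z)).
by rewrite (le_trans (cabsD _ _))// [leRHS]mulrDr mulr1 cabsM lerD// mulrC.
Qed.

Section fromtop.
Variable T : topologicalType.
Implicit Types g h : T -> C.

(** Componentwise, because complex integrals are taken componentwise; [ccontinuousP] recovers the
    form with the modulus. *)
Definition ccontinuous g := continuous (Re \o g) /\ continuous (Im \o g).

Lemma ccontinuousP g : ccontinuous g <->
  forall x (e : R), 0 < e -> \forall y \near x, cabs (g y - g x) < e.
Proof.
split=> [[cu cv] x e e0|h].
- have e20 : 0 < e / 2 by rewrite divr_gt0.
  near=> y; apply: (le_lt_trans (cabs_le_ReIm _)).
  rewrite [e]splitr ltrD// !raddfB /=; near: y.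
    by move/cvgrPdist_lt : (cu x) => /(_ _ e20); apply: filterS => y; rewrite distrC.
  by move/cvgrPdist_lt : (cv x) => /(_ _ e20); apply: filterS => y; rewrite distrC.
- split=> x; apply/cvgrPdist_lt => e e0; move: (h x e e0); apply: filterS => y;
  apply: le_lt_trans; rewrite distrC /= -raddfB; [exact: ler_Re_cabs|exact: ler_Im_cabs].
Unshelve. all: by end_near. Qed.

Lemma ccontinuous_comp F g : ccontinuous g -> (forall x, ccontinuous_at F (g x)) ->
  ccontinuous (F \o g).
Proof.
move=> /ccontinuousP cg cF; apply/ccontinuousP => x e e0.
have [d d0 hd] := cF x e e0; move: (cg x d d0); apply: filterS => y.
exact: hd.
Qed.

Lemma ccontinuous_cst (c : C) : ccontinuous (fun=> c).
Proof. by split=> x; exact: cvg_cst. Qed.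

Lemma ccontinuousD g h : ccontinuous g -> ccontinuous h ->
  ccontinuous (fun x => g x + h x).
Proof.
move=> [g1 g2] [h1 h2]; split => x.
  have -> : Re \o (fun x => g x + h x) = (Re \o g) \+ (Re \o h).
    by apply/funext => y /=; rewrite raddfD.
  exact: (continuousD (g1 x) (h1 x)).
have -> : Im \o (fun x => g x + h x) = (Im \o g) \+ (Im \o h).
  by apply/funext => y /=; rewrite raddfD.
exact: (continuousD (g2 x) (h2 x)).
Qed.

Lemma ccontinuousM g h : ccontinuous g -> ccontinuous h ->
  ccontinuous (fun x => g x * h x).
Proof.
move=> [g1 g2] [h1 h2]; split => x.
  have -> : Re \o (fun x => g x * h x) =
     (Re \o g) \* (Re \o h) \- (Im \o g) \* (Im \o h).
    by apply/funext => y /=; case: (g y) => a b; case: (h y).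
  exact: (continuousB (continuousM (g1 x) (h1 x)) (continuousM (g2 x) (h2 x))).
have -> : Im \o (fun x => g x * h x) =
   (Re \o g) \* (Im \o h) \+ (Im \o g) \* (Re \o h).
  by apply/funext => y /=; case: (g y) => a b; case: (h y).
exact: (continuousD (continuousM (g1 x) (h2 x)) (continuousM (g2 x) (h1 x))).
Qed.

Lemma ccontinuousB g h : ccontinuous g -> ccontinuous h ->
  ccontinuous (fun x => g x - h x).
Proof.
move=> cg ch; have := ccontinuousD cg (ccontinuousM (ccontinuous_cst (-1)) ch).
by under [X in ccontinuous X]eq_fun do rewrite mulN1r.
Qed.

Lemma ccontinuousX g n : ccontinuous g -> ccontinuous (fun x => g x ^+ n).
Proof.
move=> cg; elim: n => [|n IHn]; first exact: ccontinuous_cst.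
by under [X in ccontinuous X]eq_fun do rewrite exprS; exact: ccontinuousM.
Qed.

Lemma ccontinuous_cabs g : ccontinuous g -> continuous (fun x => cabs (g x)).
Proof.
move=> /ccontinuousP cg x; apply/cvgrPdist_lt => e e0.
move: (cg x e e0); apply: filterS => y; apply: le_lt_trans.
rewrite ler_norml (cabs_distC (g y)) cabs_lebD andbT lerNl opprB cabs_distC.
exact: cabs_lebD.
Qed.

Lemma ccontinuous_real (u : T -> R) : continuous u -> ccontinuous (fun x => (u x)%:C).
Proof. by move=> cu; split=> x; [exact: cu|exact: cvg_cst]. Qed.

Lemma ccontinuous_expi (u : T -> R) : continuous u -> ccontinuous (fun x => expi (u x)).
Proof.
move=> cu; split=> x.
  exact: (continuous_comp (cu x) (@continuous_cos R _)).
exact: (continuous_comp (cu x) (@continuous_sin R _)).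
Qed.

End fromtop.

Lemma ccontinuous_atV (z : C) : z != 0 -> ccontinuous_at (fun w => w^-1) z.
Proof.
move=> z0 e e0; have c0 : 0 < cabs z by rewrite cabs_gt0.
exists (Num.min (cabs z / 2) (e * (cabs z * (cabs z / 2)))).
  by rewrite lt_min divr_gt0//= !mulr_gt0.
move=> w; rewrite lt_min => /andP[w1 w2].
have wz : cabs z / 2 < cabs w.
  by have := cabs_lebD z w; rewrite cabs_distC; lra.
have w0 : w != 0 by rewrite -cabs_gt0 (le_lt_trans _ wz)// divr_ge0// ltW.
have -> : w^-1 - z^-1 = (z - w) / (z * w) by field; rewrite w0 z0.
rewrite cabsM cabsV cabsM ltr_pdivrMr ?mulr_gt0// ?cabs_gt0//.
rewrite cabs_distC (lt_trans w2)// ltr_pM2l// ltr_pM2l//.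
Qed.

End ComplexContinuity.

(** * Real integrals *)

Lemma continuous_pair (T U V : topologicalType) (f : T -> U) (g : T -> V) :
  continuous f -> continuous g -> continuous (fun x => (f x, g x)).
Proof. by move=> cf cg x; exact: (cvg_pair (cf x) (cg x)). Qed.

Section RealIntegral.
Variable R : realType.
Local Notation mu := (@lebesgue_measure R).
Implicit Types (u v F : R -> R) (a b c x : R).

Definition rint a b u := Rintegral mu `[a, b]%classic u.

Lemma continuous_integrable_itv a b u : continuous u ->
  mu.-integrable `[a, b]%classic (EFin \o u).
Proof.
move=> cu; apply: continuous_compact_integrable; first exact: segment_compact.
by apply: continuous_subspaceT => x; exact: cu.
Qed.

Lemma rintD a b u v : continuous u -> continuous v ->
  rint a b (fun x => u x + v x) = rint a b u + rint a b v.
Proof. by move=> cu cv; apply: RintegralD => //; exact: continuous_integrable_itv. Qed.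

Lemma rintZ a b c u : continuous u -> rint a b (fun x => c * u x) = c * rint a b u.
Proof. by move=> cu; apply: RintegralZl => //; exact: continuous_integrable_itv. Qed.

Lemma rint_cst a b c : a <= b -> rint a b (fun=> c) = c * (b - a).
Proof.
move=> ab; rewrite /rint Rintegral_cst//; congr (_ * _).
have mE := lebesgue_measure_itv `[a, b]; rewrite /= lte_fin -EFinB in mE.
transitivity (fine (if a < b then (b - a)%:E else 0%E)); first by congr fine.
by case: ltgtP ab => //= -> _; rewrite subrr.
Qed.

Lemma ler_rint a b u v : continuous u -> continuous v ->
  (forall x, a <= x <= b -> u x <= v x) -> rint a b u <= rint a b v.
Proof.
move=> cu cv uv; apply: (le_Rintegral _ (continuous_integrable_itv a b cu)
  (continuous_integrable_itv a b cv)) => // x /=; rewrite in_itv /=; exact: uv.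
Qed.

Lemma rint_bound a b u c : a <= b -> continuous u ->
  (forall x, a <= x <= b -> `|u x| <= c) -> `|rint a b u| <= c * (b - a).
Proof.
move=> ab cu uc; rewrite ler_norml -mulNr -!rint_cst//.
have cc (d : R) : continuous (fun _ : R => d) by move=> x; exact: cvg_cst.
apply/andP; split.
  by apply: (ler_rint (cc _) cu) => x /uc; rewrite ler_norml => /andP[].
by apply: (ler_rint cu (cc _)) => x /uc; rewrite ler_norml => /andP[].
Qed.

Lemma rint_split a b c u : continuous u -> a <= b -> b <= c ->
  rint a c u = rint a b u + rint b c u.
Proof.
move=> cu ab bc; rewrite /rint.
have := @Rintegral_itvB R u (BLeft a) (BRight c) b (continuous_integrable_itv a c cu).
rewrite !bnd_simp => /(_ ab bc) h.
rewrite -(@Rintegral_itv_obnd_cbnd _ b); first by rewrite -h addrC subrK.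
apply: integrableS (continuous_integrable_itv b c cu) => //.
by apply: subset_itvr; rewrite bnd_simp.
Qed.

Lemma rint_FTC2 a b u F : a <= b -> continuous u ->
  (forall x, a <= x <= b -> is_derive x 1 F (u x)) -> rint a b u = F b - F a.
Proof.
rewrite le_eqVlt => /predU1P[<-|ab] cu dF.
  rewrite subrr; apply/eqP; rewrite -normr_le0.
  have [M uM] : exists M, forall x, a <= x <= a -> `|u x| <= M.
    exists `|u a| => x; rewrite -eq_le => /eqP <-; exact: lexx.
  by rewrite (le_trans (rint_bound (lexx a) cu uM))// subrr mulr0.
have cF x : a <= x <= b -> {for x, continuous F}.
  move=> /dF df; apply: differentiable_continuous; apply/derivable1_diffP.
  exact: ex_derive.
rewrite /rint /Rintegral (@continuous_FTC2 _ u F a b ab) //.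
- by apply: continuous_subspaceT => x; exact: cu.
- split.
  + move=> x; rewrite in_itv /= => /andP[/ltW ax /ltW xb].
    by have [] : is_derive x 1 F (u x) by apply: dF; rewrite ax.
  + apply: cvg_at_right_filter; apply: cF; by rewrite lexx ltW.
  + apply: cvg_at_left_filter; apply: cF; by rewrite lexx ltW.
- move=> x; rewrite in_itv /= => /andP[/ltW ax /ltW xb].
  by rewrite derive1E; apply: derive_val; apply: dF; rewrite ax.
Qed.

Lemma rint_id a b : a <= b -> rint a b id = (b ^+ 2 - a ^+ 2) / 2.
Proof.
move=> ab.
have dF (x : R) : is_derive x 1 (fun y : R => y ^+ 2 / 2) x.
  have -> : (fun y : R => y ^+ 2 / 2) = 2^-1 \*: (id ^+ 2 : R -> R).
    by apply/funext => y; rewrite /= mulrC.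
  apply: is_derive_eq; rewrite /GRing.scale /= expr1 mulr1; by field.
have cid : continuous (id : R -> R) by move=> t; exact: cvg_id.
by rewrite (rint_FTC2 ab cid (fun y _ => dF y)) mulrBl.
Qed.

Lemma primitive_right a u : continuous u ->
  exists F, forall x, a < x -> is_derive x 1 F (u x).
Proof.
move=> cu; exists (fun x => rint a x u) => x ax.
have xx : x < x + 1 by rewrite ltrDl.
have [h1 h2] := continuous_FTC1_closed xx (continuous_integrable_itv a (x + 1) cu)
  ax (cu x).
by rewrite derive1E in h2; exact: (DeriveDef h1 h2).
Qed.

Lemma is_derive_shift F (x c d : R) : is_derive (x + c) 1 F d ->
  is_derive x 1 (fun y => F (y + c)) d.
Proof.
move=> dF.
have h : is_derive x 1 (fun y : R => y + c) 1.
  by apply: is_derive_eq; rewrite addr0.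
have := @is_derive1_comp _ F (fun y => y + c) x d 1 dF h.
by rewrite mulr1.
Qed.

(** For a primitive F of u, F(x + T) - F(x) has derivative 0 by periodicity; its values at [th] and
    0 are the two integrals. *)
Lemma rint_periodic_shift (T th : R) u : continuous u -> 0 <= T ->
  (forall x, u (x + T) = u x) -> rint 0 T (fun x => u (x + th)) = rint 0 T u.
Proof.
(* [primitive_right] differentiates only to the right of its base point, hence a base point below
   both 0 and [th]. *)
move=> cu T0 uT; pose m := Num.min 0 th - 1.
have m0 : m < 0 by rewrite /m ltrBlDr add0r gt_min ltr01.
have mth : m < th by rewrite /m ltrBlDr gt_min ltrDl ltr01 orbT.
have [F dF] := primitive_right m cu.
pose Q x := F (x + T) - F x.
have dQ x : m < x -> is_derive x 1 Q 0.
  move=> mx; rewrite -(subrr (u x)); apply: is_deriveB; last exact: dF.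
  by apply: is_derive_shift; rewrite -[u x]uT; apply: dF; rewrite ltr_wpDr.
have c0 : continuous (fun _ : R => 0 : R) by move=> x; exact: cvg_cst.
have r0 a b : a <= b -> rint a b (fun=> 0 : R) = 0 by move=> /rint_cst ->; rewrite mul0r.
have Q0 : Q th = Q 0.
  have Qab a b : m < a -> a <= b -> Q b = Q a.
    move=> ma ab; apply/eqP; rewrite -subr_eq0.
    have dQ' x : a <= x <= b -> is_derive x 1 Q 0.
      by move=> /andP[ax _]; apply: dQ; rewrite (lt_le_trans ma).
    by rewrite -(rint_FTC2 ab c0 dQ') r0.
  by case: (leP 0 th) => h; [exact: Qab|rewrite (Qab th 0)// ltW].
have cut : continuous (fun x => u (x + th)).
  move=> x; apply: (@continuous_comp _ _ _ (fun y => y + th) u); last exact: cu.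
  by apply: cvgD; [exact: cvg_id|exact: cvg_cst].
have dF1 x : 0 <= x <= T -> is_derive x 1 (fun x => F (x + th)) (u (x + th)).
  move=> /andP[x0 _]; apply: is_derive_shift; apply: dF.
  by rewrite (lt_le_trans mth)// lerDr.
have dF2 x : 0 <= x <= T -> is_derive x 1 F (u x).
  by move=> /andP[x0 _]; apply: dF; rewrite (lt_le_trans m0).
rewrite (rint_FTC2 T0 cut dF1) (rint_FTC2 T0 cu dF2).
by move: Q0; rewrite /Q !add0r (addrC th).
Qed.

Lemma compact_rect_bounded (K : R * R -> R) (a b c d : R) : continuous K ->
  exists M, forall x y, a <= x <= b -> c <= y <= d -> `|K (x, y)| <= M.
Proof.
move=> cK.
have /compact_bounded[M [_ hM]] : compact (K @` (`[a, b]%classic `*` `[c, d]%classic)).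
  apply: continuous_compact; first by apply: continuous_subspaceT => x; exact: cK.
  by apply: compact_setX; exact: segment_compact.
exists (M + 1) => x y xab ycd; apply: (hM (M + 1)); first by rewrite ltrDl.
by exists (x, y) => //; split => /=; rewrite in_itv /=.
Qed.

(** Continuity under the integral sign, dominated by the maximum of |K| over a compact rectangle
    around [s0]. It makes circle means continuous in the radius. *)
Lemma continuous_rint_param (K : R * R -> R) (a b : R) : continuous K ->
  continuous (fun s => rint a b (fun t => K (s, t))).
Proof.
move=> cK s0.
have [M hM] := compact_rect_bounded (s0 - 1) (s0 + 1) a b cK.
have cpair1 (s : R) : continuous (fun t => K (s, t)).
  move=> t; apply: (@continuous_comp _ _ _ (fun t : R => (s, t)) K); last exact: cK.
  by apply: continuous_pair => y; [exact: cvg_cst|exact: cvg_id].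
have cpair2 (t : R) : continuous (fun s => K (s, t)).
  move=> s; apply: (@continuous_comp _ _ _ (fun s : R => (s, t)) K); last exact: cK.
  by apply: continuous_pair => y; [exact: cvg_id|exact: cvg_cst].
apply: (@continuity_under_integral R _ _ mu (fun s t => K (s, t)) `[a, b]%classic
  _ (s0 - 1) (s0 + 1) _ _ (fun=> M)) => //.
- by move=> s _; apply: continuous_integrable_itv.
- apply: aeW => t _ s _. exact: cpair2.
- by apply: continuous_integrable_itv => t; exact: cvg_cst.
- move=> s; rewrite /= in_itv /= => /andP[/ltW s1 /ltW s2]; apply: aeW => t /=.
  by rewrite in_itv /= => tab; apply: hM; rewrite ?s1.
- by rewrite inE /= in_itv /= ltrBlDr ltrDl ltr01.
Qed.

End RealIntegral.

(** * Complex integrals and Goursat's lemma *)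

Local Arguments cabs : simpl never.

Section ComplexIntegral.
Variable R : realType.
Local Notation C := R[i].
Implicit Types (g h : R -> C) (a b c d x y : R).

Definition ci a b g : C := rint a b (Re \o g) +i* rint a b (Im \o g).

Arguments ci : simpl never.

Lemma ci_eq a b g h : (forall x, a <= x <= b -> g x = h x) -> ci a b g = ci a b h.
Proof.
by move=> gh; congr (_ +i* _); apply: eq_Rintegral => x;
  rewrite inE /= in_itv /= => /gh ->.
Qed.

Lemma ciD a b g h : ccontinuous g -> ccontinuous h ->
  ci a b (fun x => g x + h x) = ci a b g + ci a b h.
Proof.
move=> [g1 g2] [h1 h2]; rewrite /ci /=; apply/eqP; rewrite eq_complex /=.
rewrite -!rintD//; apply/andP; split; apply/eqP; congr rint; apply/funext => x /=;
  exact: raddfD.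
Qed.

Lemma ciZ a b (k : C) g : ccontinuous g -> ci a b (fun x => k * g x) = k * ci a b g.
Proof.
case: k => k1 k2 [g1 g2].
have cZ (k : R) (u : R -> R) : continuous u -> continuous (fun x => k * u x).
  by move=> cu x; apply: (continuousM (cvg_cst _) (cu x)).
rewrite /ci; apply/eqP; rewrite eq_complex /= -mulNr.
rewrite -!rintZ// -!rintD//; try exact: cZ.
by apply/andP; split; apply/eqP; congr rint; apply/funext => x /=;
  case: (g x) => u v /=; rewrite ?mulNr.
Qed.

Lemma ciB a b g h : ccontinuous g -> ccontinuous h ->
  ci a b (fun x => g x - h x) = ci a b g - ci a b h.
Proof.
move=> cg ch; rewrite -mulN1r -ciZ// -ciD//; last first.
  by apply: ccontinuousM => //; exact: ccontinuous_cst.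
by apply: ci_eq => x _; rewrite mulN1r.
Qed.

Lemma ci_split a b c g : ccontinuous g -> a <= b -> b <= c ->
  ci a c g = ci a b g + ci b c g.
Proof.
move=> [g1 g2] ab bc; rewrite /ci (rint_split g1 ab bc) (rint_split g2 ab bc).
by [].
Qed.

(** Real and imaginary parts are estimated separately, whence the factor 2. It reappears in
    [coef_bound] and [entire_tail_bound] and does not affect exponential rates. *)
Lemma ci_bound a b g (M : R) : a <= b -> ccontinuous g ->
  (forall x, a <= x <= b -> cabs (g x) <= M) -> cabs (ci a b g) <= 2 * M * (b - a).
Proof.
move=> ab [g1 g2] gM; apply: (le_trans (cabs_le_ReIm _)).
rewrite -mulrA mulr_natl mulr2n lerD//; apply: rint_bound => // x /gM; apply: le_trans.
  exact: ler_Re_cabs.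
exact: ler_Im_cabs.
Qed.

Lemma ci_cst a b (k : C) : a <= b -> ci a b (fun=> k) = k * (b - a)%:C.
Proof.
move=> ab; rewrite /ci (rint_cst _ ab) (rint_cst _ ab); case: k => k1 k2.
by apply/eqP; rewrite eq_complex /= !mulr0 subr0 add0r !eqxx.
Qed.

Lemma ccontinuous_id : ccontinuous (fun x : R => x%:C).
Proof. by apply: ccontinuous_real => x; exact: cvg_id. Qed.

Lemma ci_id a b : a <= b -> ci a b (fun x => x%:C) = ((b ^+ 2 - a ^+ 2) / 2)%:C.
Proof.
move=> ab; rewrite /ci -(rint_id ab); congr (_ +i* _).
by have := rint_cst (0 : R) ab; rewrite mul0r.
Qed.

Lemma ci_affine a b (k l : C) : a <= b ->
  ci a b (fun x => k + l * x%:C) = k * (b - a)%:C + l * ((b ^+ 2 - a ^+ 2) / 2)%:C.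
Proof.
move=> ab; rewrite ciD; first by rewrite ciZ ?ci_cst ?ci_id//; exact: ccontinuous_id.
  exact: ccontinuous_cst.
by apply: ccontinuousM; [exact: ccontinuous_cst|exact: ccontinuous_id].
Qed.

End ComplexIntegral.

Section Goursat.
Variable R : realType.
Local Notation C := R[i].

Lemma nested_point (u w : nat -> R) : (forall n, u n <= u n.+1) ->
  (forall n, u n.+1 + w n.+1 <= u n + w n) -> (forall n, 0 <= w n) ->
  exists x, forall n, u n <= x <= u n + w n.
Proof.
move=> u1 w1 w0.
have nd : {homo u : m n / (m <= n)%N >-> m <= n}.
  by apply: homo_leq => //; [exact: le_trans].
have ni : {homo (fun n => u n + w n) : m n / (m <= n)%N >-> n <= m}.
  by apply: (@homo_leq _ _ (fun x y => y <= x)) => // x y z h1 h2; exact: le_trans h1.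
have uw m n : u m <= u n + w n.
  apply: (le_trans (nd _ _ (leq_maxl m n))).
  apply: le_trans (ni _ _ (leq_maxr m n)); by rewrite lerDl.
have hs : has_sup (range u).
  by split; [exists (u 0%N), 0%N|exists (u 0%N + w 0%N) => _ [n _ <-]].
exists (sup (range u)) => n; apply/andP; split.
  by apply: ub_le_sup; [exact: hs.2|exists n].
by apply: ge_sup; [exact: hs.1|move=> _ [m _ <-]].
Qed.

(** The counterclockwise integral of H dz over the boundary of [a, b] x [c, d]: dz is dx on
    horizontal sides and i dy on vertical ones. *)
Definition rect_integral (H : R -> R -> C) a b c d : C :=
  ci a b (fun x => H x c) + 'i * ci c d (fun y => H b y)
  - ci a b (fun x => H x d) - 'i * ci c d (fun y => H a y).

Arguments rect_integral : simpl never.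

(** Complex differentiability of x + iy -> H x y, with increments measured in the sum norm, which
    fits rectangles. *)
Definition rdiff (H : R -> R -> C) x0 y0 := exists A : C, forall e : R, 0 < e ->
  exists2 d : R, 0 < d & forall x y, `|x - x0| < d -> `|y - y0| < d ->
    cabs (H x y - H x0 y0 - A * ((x - x0) +i* (y - y0))) <= e * (`|x - x0| + `|y - y0|).

Variable H : R -> R -> C.
Hypothesis cH : ccontinuous (fun p : R * R => H p.1 p.2).

Lemma ccontinuous_sliceh (K : R -> R -> C) y :
  ccontinuous (fun p : R * R => K p.1 p.2) -> ccontinuous (fun x => K x y).
Proof.
have cp : continuous (fun x : R => (x, y)).
  by apply: continuous_pair => x; [exact: cvg_id|exact: cvg_cst].
move=> [k1 k2]; split => x.
  exact: (continuous_comp (cp x) (k1 (x, y))).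
exact: (continuous_comp (cp x) (k2 (x, y))).
Qed.

Lemma ccontinuous_slicev (K : R -> R -> C) x :
  ccontinuous (fun p : R * R => K p.1 p.2) -> ccontinuous (fun y => K x y).
Proof.
have cp : continuous (fun y : R => (x, y)).
  by apply: continuous_pair => y; [exact: cvg_cst|exact: cvg_id].
move=> [k1 k2]; split => y.
  exact: (continuous_comp (cp y) (k1 (x, y))).
exact: (continuous_comp (cp y) (k2 (x, y))).
Qed.

Let chH y := ccontinuous_sliceh y cH.
Let cvH x := ccontinuous_slicev x cH.

Lemma rect_integral_quarter a m b c n d : a <= m -> m <= b -> c <= n -> n <= d ->
  rect_integral H a b c d = rect_integral H a m c n + rect_integral H m b c n + rect_integral H a m n d + rect_integral H m b n d.
Proof.
move=> am mb cn nd; rewrite /rect_integral.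
rewrite (ci_split (chH c) am mb) (ci_split (chH d) am mb).
rewrite (ci_split (cvH a) cn nd) (ci_split (cvH b) cn nd).
ring.
Qed.

Lemma rect_integral_affine (k l : C) a b c d : a <= b -> c <= d ->
  rect_integral (fun x y => k + l * (x +i* y)) a b c d = 0.
Proof.
move=> ab cd.
have E (x y : R) : x +i* y = x%:C + 'i * y%:C by rewrite [LHS]complexE.
have h y : ci a b (fun x => k + l * (x +i* y)) =
    (k + l * ('i * y%:C)) * (b - a)%:C + l * ((b ^+ 2 - a ^+ 2) / 2)%:C.
  rewrite -ci_affine//; apply: ci_eq => x _; rewrite E; ring.
have v x : ci c d (fun y => k + l * (x +i* y)) =
    (k + l * x%:C) * (d - c)%:C + l * 'i * ((d ^+ 2 - c ^+ 2) / 2)%:C.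
  rewrite -ci_affine//; apply: ci_eq => y _; rewrite E; ring.
rewrite /rect_integral !h !v !rmorphM !rmorphB !rmorphXn /=.
have -> : (2^-1 : R)%:C = (2^-1 : C) by rewrite fmorphV rmorph_nat.
have i2 : ('i : C) * 'i = -1 by rewrite -expr2 sqr_i.
set u := b%:C; set v' := a%:C; set p := c%:C; set q := d%:C.
have -> : l * 'i * ((q ^+ 2 - p ^+ 2) / 2) = 'i * (l * ((q ^+ 2 - p ^+ 2) / 2)) by ring.
ring.
Qed.

Lemma rect_integral_bound (K : R -> R -> C) (M : R) a b c d :
  ccontinuous (fun p : R * R => K p.1 p.2) -> a <= b -> c <= d ->
  (forall x y, a <= x <= b -> c <= y <= d -> cabs (K x y) <= M) ->
  cabs (rect_integral K a b c d) <= 4 * M * ((b - a) + (d - c)).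
Proof.
move=> cK ab cd KM.
have h y : c <= y <= d -> cabs (ci a b (fun x => K x y)) <= 2 * M * (b - a).
  by move=> hy; apply: ci_bound => //; [exact: ccontinuous_sliceh|move=> x hx; exact: KM].
have v x : a <= x <= b -> cabs ('i * ci c d (fun y => K x y)) <= 2 * M * (d - c).
  move=> hx; rewrite cabsM cabs_i mul1r.
  by apply: ci_bound => //; [exact: ccontinuous_slicev|move=> y hy; exact: KM].
have t4 (p q r s : C) : cabs (p + q - r - s) <= cabs p + cabs q + cabs r + cabs s.
  by rewrite (le_trans (cabsB _ _))// lerD2r (le_trans (cabsB _ _))// lerD2r cabsD.
apply: (le_trans (t4 _ _ _ _)).
have -> : 4 * M * (b - a + (d - c)) =
   2 * M * (b - a) + 2 * M * (d - c) + 2 * M * (b - a) + 2 * M * (d - c) by ring.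
by rewrite !lerD ?h ?v ?lexx ?ab ?cd.
Qed.


(** After [k] halvings the sides are known, so a rectangle is recorded by its lower left corner
    alone. *)
Let Q l1 l2 (k : nat) (p : R * R) : R :=
  cabs (rect_integral H p.1 (p.1 + l1 / 2 ^+ k) p.2 (p.2 + l2 / 2 ^+ k)).

(** The integral is the sum over the four quarters, so one quarter carries at least a fourth of its
    modulus. *)
Lemma rect_integral_halve l1 l2 k (p : R * R) : 0 <= l1 -> 0 <= l2 ->
  exists q : R * R, [/\ p.1 <= q.1, q.1 + l1 / 2 ^+ k.+1 <= p.1 + l1 / 2 ^+ k,
    p.2 <= q.2, q.2 + l2 / 2 ^+ k.+1 <= p.2 + l2 / 2 ^+ k &
    Q l1 l2 k p <= 4 * Q l1 l2 k.+1 q].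
Proof.
move=> l1_ge0 l2_ge0; case: p => a c /=.
pose w1 := l1 / 2 ^+ k.+1; pose w2 := l2 / 2 ^+ k.+1.
have w1_ge0 : 0 <= w1 by rewrite divr_ge0// exprn_ge0.
have w2_ge0 : 0 <= w2 by rewrite divr_ge0// exprn_ge0.
have W l : l / 2 ^+ k = l / 2 ^+ k.+1 + l / 2 ^+ k.+1 :> R.
  by rewrite exprS invfM; field; rewrite expf_neq0.
rewrite /Q /= !W -/w1 -/w2 !addrA.
have aw : a <= a + w1 by rewrite lerDl.
have aw' : a + w1 <= a + w1 + w1 by rewrite lerDl.
have cw : c <= c + w2 by rewrite lerDl.
have cw' : c + w2 <= c + w2 + w2 by rewrite lerDl.
rewrite (rect_integral_quarter aw aw' cw cw').
set X := rect_integral H a (a + w1) c (c + w2) + _ + _ + _.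
have [] : [\/ cabs X <= 4 * cabs (rect_integral H a (a + w1) c (c + w2)),
   cabs X <= 4 * cabs (rect_integral H (a + w1) (a + w1 + w1) c (c + w2)),
   cabs X <= 4 * cabs (rect_integral H a (a + w1) (c + w2) (c + w2 + w2)) |
   cabs X <= 4 * cabs (rect_integral H (a + w1) (a + w1 + w1) (c + w2) (c + w2 + w2))].
  rewrite /X; set x1 := rect_integral _ _ _ _ _; set x2 := rect_integral _ _ _ _ _.
  set x3 := rect_integral _ _ _ _ _; set x4 := rect_integral _ _ _ _ _.
  have := cabsD (x1 + x2 + x3) x4; have := cabsD (x1 + x2) x3; have := cabsD x1 x2.
  set y := cabs (x1 + x2 + x3 + x4).
  case: (leP y (4 * cabs x1)) => h1; first by constructor 1.
  case: (leP y (4 * cabs x2)) => h2; first by constructor 2.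
  case: (leP y (4 * cabs x3)) => h3; first by constructor 3.
  case: (leP y (4 * cabs x4)) => h4; first by constructor 4.
  move=> t1 t2 t3; exfalso; lra.
- by exists (a, c); split => //=.
- by exists (a + w1, c); split => //=.
- by exists (a, c + w2); split => //=.
- by exists (a + w1, c + w2); split => //=.
Qed.

Lemma goursat a c l1 l2 : 0 <= l1 -> 0 <= l2 ->
  (forall x y, a <= x <= a + l1 -> c <= y <= c + l2 -> rdiff H x y) ->
  rect_integral H a (a + l1) c (c + l2) = 0.
Proof.
move=> l1_ge0 l2_ge0 dH.
have [nxt nxtP] := choice (fun kp : nat * (R * R) =>
  @rect_integral_halve l1 l2 kp.1 kp.2 l1_ge0 l2_ge0).
pose s := fix s n := if n is m.+1 then nxt (m, s m) else (a, c).
have sP n : [/\ (s n).1 <= (s n.+1).1,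
    (s n.+1).1 + l1 / 2 ^+ n.+1 <= (s n).1 + l1 / 2 ^+ n,
    (s n).2 <= (s n.+1).2, (s n.+1).2 + l2 / 2 ^+ n.+1 <= (s n).2 + l2 / 2 ^+ n &
    Q l1 l2 n (s n) <= 4 * Q l1 l2 n.+1 (s n.+1)] by exact: (nxtP (n, s n)).
have p0 n : 0 <= (2 ^+ n)^-1 :> R by rewrite invr_ge0 exprn_ge0.
have [|||x0 hx0] := @nested_point (fun n => (s n).1) (fun n => l1 / 2 ^+ n).
- by move=> n; case: (sP n).
- by move=> n; case: (sP n).
- by move=> n; rewrite mulr_ge0.
have [|||y0 hy0] := @nested_point (fun n => (s n).2) (fun n => l2 / 2 ^+ n).
- by move=> n; case: (sP n).
- by move=> n; case: (sP n).
- by move=> n; rewrite mulr_ge0.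
have Qn n : Q l1 l2 0 (a, c) <= 4 ^+ n * Q l1 l2 n (s n).
  elim: n => [|n IHn]; first by rewrite mul1r.
  apply: (le_trans IHn); rewrite exprSr -mulrA ler_pM2l ?exprn_gt0//.
  by case: (sP n).
have [A hA] : rdiff H x0 y0.
  apply: dH; first by have := hx0 0%N; rewrite /= expr0 divr1.
  by have := hy0 0%N; rewrite /= expr0 divr1.
have L0 : 0 <= l1 + l2 by rewrite addr_ge0.
(* After n quarterings the remainder is at most e (l1 + l2)/2^n on a rectangle whose two side
   lengths add up to (l1 + l2)/2^n; the product, with the 4 of [rect_integral_bound], cancels the
   accumulated 4^n. *)
suff QE (e : R) : 0 < e -> Q l1 l2 0 (a, c) <= 4 * e * (l1 + l2) ^+ 2.
  apply/eqP; rewrite -cabs_eq0 eq_le cabs_ge0 andbT.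
  apply/ler_addgt0Pr => e e0; rewrite add0r.
  set D := (l1 + l2) ^+ 2 in QE *; have D0 : 0 <= D by exact: sqr_ge0.
  have den : 0 < 4 * (D + 1) by rewrite mulr_gt0// ltr_wpDl.
  have := QE (e / (4 * (D + 1))); rewrite divr_gt0// => /(_ isT).
  rewrite /Q /= expr0 !divr1 => /le_trans; apply.
  have -> : 4 * (e / (4 * (D + 1))) * D = e * (4 * D / (4 * (D + 1))) by ring.
  by rewrite ler_piMr ?(ltW e0)// ler_pdivrMr// mul1r ler_pM2l// lerDl.
move=> e0; have [d d0 hd] := hA e e0.
have [n hn] : exists n : nat, (l1 + l2) / 2 ^+ n < d.
  exists (Num.truncn ((l1 + l2) / d)).+1; rewrite ltr_pdivrMr ?exprn_gt0//.
  rewrite mulrC -ltr_pdivrMr//; apply: (lt_le_trans (truncnS_gt _)).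
  by rewrite -natrX ler_nat ltnW// ltn_expl.
set t := (2 ^+ n)^-1 : R in hn *; have t0 : 0 <= t := p0 n.
have wd1 : l1 * t < d by apply: le_lt_trans hn; apply: ler_wpM2r => //; rewrite lerDl.
have wd2 : l2 * t < d by apply: le_lt_trans hn; apply: ler_wpM2r => //; rewrite lerDr.
have w1_ge0 : 0 <= l1 * t by rewrite mulr_ge0.
have w2_ge0 : 0 <= l2 * t by rewrite mulr_ge0.
have := hx0 n; have := hy0 n; have := Qn n; rewrite {2}/Q -/t.
case: (s n) => u v /= QE hv hu.
(* [H] splits into the affine part [L], whose boundary integral vanishes, and the first-order
   remainder [K], which is small near (x0, y0). *)
pose K x y := H x y - H x0 y0 - A * ((x - x0) +i* (y - y0)).
have cK2 : ccontinuous (fun p : R * R => A * ((p.1 - x0) +i* (p.2 - y0))).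
  apply: ccontinuousM; first exact: ccontinuous_cst.
  split => x /=; apply: cvgB; try exact: cvg_cst; [exact: cvg_fst|exact: cvg_snd].
have cK : ccontinuous (fun p : R * R => K p.1 p.2).
  by rewrite /K; apply: ccontinuousB => //; apply: ccontinuousB => //; exact: ccontinuous_cst.
pose L x y := (H x0 y0 - A * (x0 +i* y0)) + A * (x +i* y).
have cL : ccontinuous (fun p : R * R => L p.1 p.2).
  apply: ccontinuousD; first exact: ccontinuous_cst.
  apply: ccontinuousM; first exact: ccontinuous_cst.
  split => x /=; [exact: cvg_fst|exact: cvg_snd].
have uw : u <= u + l1 * t by rewrite lerDl.
have vw : v <= v + l2 * t by rewrite lerDl.
have HKL : rect_integral H u (u + l1 * t) v (v + l2 * t) = rect_integral K u (u + l1 * t) v (v + l2 * t).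
  have KL x y : H x y = K x y + L x y.
    rewrite /K /L; have -> : (x - x0) +i* (y - y0) = x +i* y - x0 +i* y0 by [].
    ring.
  have -> : rect_integral H u (u + l1 * t) v (v + l2 * t) =
     rect_integral K u (u + l1 * t) v (v + l2 * t) + rect_integral L u (u + l1 * t) v (v + l2 * t).
    rewrite /rect_integral.
    have hh y b b' : ci b b' (fun x => H x y) = ci b b' (fun x => K x y) + ci b b' (fun x => L x y).
      rewrite -ciD; [by apply: ci_eq => x _; exact: KL|exact: ccontinuous_sliceh..].
    have vv x b b' : ci b b' (fun y => H x y) = ci b b' (fun y => K x y) + ci b b' (fun y => L x y).
      rewrite -ciD; [by apply: ci_eq => y _; exact: KL|exact: ccontinuous_slicev..].
    rewrite !hh !vv; ring.
  by rewrite rect_integral_affine// addr0.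
apply: (le_trans QE); rewrite HKL.
have := @rect_integral_bound K (e * ((l1 + l2) * t)) u (u + l1 * t) v (v + l2 * t) cK uw vw.
have dist z0 z w (l : R) : w <= z0 <= w + l -> w <= z <= w + l -> `|z - z0| <= l.
  by move=> /andP[h1 h2] /andP[h3 h4]; rewrite ler_norml; apply/andP; split; lra.
move=> KB.
have {}KB : cabs (rect_integral K u (u + l1 * t) v (v + l2 * t)) <=
  4 * (e * ((l1 + l2) * t)) * (l1 * t + l2 * t).
  have -> : l1 * t + l2 * t = u + l1 * t - u + (v + l2 * t - v) by ring.
  apply: KB => x y hx hy.
  have dx := dist _ _ _ _ hu hx; have dy := dist _ _ _ _ hv hy.
  apply: (le_trans (hd x y (le_lt_trans dx wd1) (le_lt_trans dy wd2))).
  by rewrite ler_pM2l// mulrDl lerD.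
have t4 : 4 ^+ n * (t * t) = 1.
  rewrite /t -invfM -exprMn_comm; last exact: commr_refl.
  by rewrite (_ : 2 * 2 = 4)  ?divff ?expf_neq0// -natrM.
have := ler_wpM2l (exprn_ge0 n (ler0n R 4)) KB; move=> /le_trans; apply.
rewrite [leLHS](_ : _ = 4 ^+ n * (t * t) * (4 * e * (l1 + l2) ^+ 2)); last by ring.
by rewrite t4 mul1r.
Qed.

End Goursat.

(** * Means over circles *)

Section CircleMean.
Variable R : realType.
Local Notation C := R[i].
Implicit Types (Phi : C -> C) (r s t u v x y : R) (z w : C).

Definition polexp s t : C := (expR s)%:C * expi t.

Lemma cabs_polexp s t : cabs (polexp s t) = expR s.
Proof. by rewrite cabsM cabs_expi mulr1 cabs_real ger0_norm// expR_ge0. Qed.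

Lemma polexp_neq0 s t : polexp s t != 0.
Proof. by rewrite -cabs_gt0 cabs_polexp expR_gt0. Qed.

Lemma polexpD s t u v : polexp (s + u) (t + v) = polexp s t * polexp u v.
Proof. by rewrite /polexp expRD expiD rmorphM /= mulrACA. Qed.

Lemma continuous_polexp : ccontinuous (fun p : R * R => polexp p.1 p.2).
Proof.
apply: ccontinuousM.
  apply: ccontinuous_real => p.
  exact: (continuous_comp (@cvg_fst _ _ _ _ _) (@continuous_expR R _)).
by apply: ccontinuous_expi => p; exact: cvg_snd.
Qed.

Lemma real_derive_norm (f : R -> R) x d e : is_derive x 1 f d -> 0 < e ->
  exists2 d' : R, 0 < d' & forall h, `|h| < d' ->
    `|f (x + h) - f x - d * h| <= e * `|h|.
Proof.
move=> df e0; have [fd <-] : derivable f x 1 /\ 'D_1 f x = d.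
  by split; [exact: ex_derive|exact: derive_val].
exact: (@derivable_norm R f x e fd e0).
Qed.

Lemma expi_diff0 e : 0 < e -> exists2 d : R, 0 < d & forall v, `|v| < d ->
  cabs (expi v - 1 - 'i * v%:C) <= e * `|v|.
Proof.
move=> e0; have e2 : 0 < e / 2 by rewrite divr_gt0.
have [d1 d10 h1] := real_derive_norm (is_derive_cos (0 : R)) e2.
have [d2 d20 h2] := real_derive_norm (is_derive_sin (0 : R)) e2.
exists (Num.min d1 d2); first by rewrite lt_min d10.
move=> v; rewrite lt_min => /andP[/h1 {}h1 /h2 {}h2].
apply: (le_trans (cabs_le_ReIm _)); rewrite [e]splitr mulrDl lerD//=.
  by move: h1; rewrite add0r cos0 sin0 oppr0 !mul0r mulr0 !subr0.
by move: h2; rewrite add0r cos0 sin0 !mul1r !mul0r !subr0 add0r.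
Qed.

Lemma polexp_diff0 e : 0 < e -> exists2 d : R, 0 < d & forall u v, `|u| < d -> `|v| < d ->
  cabs (polexp u v - 1 - (u +i* v)) <= e * (`|u| + `|v|).
Proof.
move=> e0; have e4 : 0 < e / 4 by rewrite divr_gt0.
have [d1 d10 h1] := real_derive_norm (is_derive_expR (0 : R)) e4.
have [d2 d20 h2] := expi_diff0 e4.
exists (Num.min (Num.min d1 d2) (Num.min 1 (e / 4))).
  by rewrite !lt_min d10 d20 ltr01.
move=> u v; rewrite !lt_min => /andP[/andP[/h1 {}h1 _] /andP[u1 u2]].
move=> /andP[/andP[_ /h2 {}h2] _].
(* Each summand involves one real expansion only: |1 + u| <= 2 because |u| < 1, and the product term
   is small because |u| < e/4. *)
have -> : polexp u v - 1 - (u +i* v) = (expR u - 1 - u)%:C * expi v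
   + (1 + u)%:C * (expi v - 1 - 'i * v%:C) + 'i * u%:C * v%:C.
  have -> : u +i* v = u%:C + 'i * v%:C by rewrite [LHS]complexE.
  rewrite /polexp rmorphD !rmorphB rmorph1 /=; ring.
rewrite (le_trans (cabsD _ _))//.
have -> : e * (`|u| + `|v|) = e / 4 * `|u| + 2 * (e / 4 * `|v|) + e / 4 * `|v|
   + (e / 4 * `|v| + 3 * (e / 4 * `|u|)) by field.
apply: (@le_trans _ _ (e / 4 * `|u| + 2 * (e / 4 * `|v|) + e / 4 * `|v|)).
  rewrite lerD//.
    rewrite (le_trans (cabsD _ _))// !cabsM cabs_expi mulr1 !cabs_real lerD//.
      by move: h1; rewrite add0r expR0 mul1r.
    rewrite ler_pM ?cabs_ge0// (le_trans (ler_normD _ _))// normr1.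
    by rewrite -[2]/(1 + 1) lerD2l ltW.
  by rewrite !cabsM cabs_i mul1r !cabs_real ler_wpM2r// ltW.
by rewrite lerDl addr_ge0// !mulr_ge0// ltW.
Qed.

Lemma rdiff_polexp Phi s t : cderivable_at Phi (polexp s t) ->
  rdiff (fun x y => Phi (polexp x y)) s t.
Proof.
move=> /cderivableP[A hA]; set z0 := polexp s t.
have z00 : 0 < cabs z0 by rewrite cabs_gt0 polexp_neq0.
exists (A * z0) => e e0.
(* Since e^(s+u+i(t+v)) = z0 q with q = e^(u+iv), the chain rule reduces to q near 1. Here [h3]
   gives |q - 1| <= 2m; [e1] and [e2] allot e/2 each to the remainders of Phi and of the
   exponential, and [d4] keeps |z0 (q - 1)| below [d1]. *)
pose e1 := e / (4 * cabs z0).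
have e10 : 0 < e1 by rewrite divr_gt0// mulr_gt0.
have [d1 d10 h1] := hA e1 e10.
pose e2 := e / (2 * ((cabs A + 1) * cabs z0)).
have A1 : 0 < cabs A + 1 by rewrite ltr_wpDl ?cabs_ge0.
have e20 : 0 < e2 by rewrite divr_gt0// !mulr_gt0.
have [d2 d20 h2] := polexp_diff0 e20.
have [d3 d30 h3] := polexp_diff0 ltr01.
pose d4 := d1 / (4 * cabs z0).
have d40 : 0 < d4 by rewrite divr_gt0// mulr_gt0.
exists (Num.min (Num.min d2 d3) d4); first by rewrite !lt_min d20 d30 d40.
move=> x y; set u := x - s; set v := y - t.
rewrite !lt_min => /andP[/andP[u2 u3] u4] /andP[/andP[v2 v3] v4].
set m := `|u| + `|v|; have m0 : 0 <= m by rewrite addr_ge0.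
have pE : polexp x y = z0 * polexp u v.
  by rewrite -polexpD /u /v !(addrC _ (_ - _)) !subrK.
have {}h2 := h2 u v u2 v2; have {}h3 := h3 u v u3 v3.
set q := polexp u v in pE h2 h3.
have uv : cabs (u +i* v) <= m by exact: cabs_le_ReIm.
have q1 : cabs (q - 1) <= 2 * m.
  rewrite -(subrK (u +i* v) (q - 1)) (le_trans (cabsD _ _))// mulr_natl mulr2n.
  by rewrite lerD// -[m]mul1r.
have zq : polexp x y = z0 + z0 * (q - 1) by rewrite pE mulrBr mulr1 addrC subrK.
have hsmall : cabs (z0 * (q - 1)) < d1.
  rewrite cabsM; apply: (@le_lt_trans _ _ (cabs z0 * (2 * m))).
    by rewrite ler_pM2l.
  have : m < 2 * d4 by rewrite /m; lra.
  rewrite -(ltr_pM2l (x := cabs z0 * 2)) ?mulr_gt0// -mulrA => /lt_le_trans; apply.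
  by rewrite le_eqVlt; apply/orP; left; apply/eqP; rewrite /d4; field; rewrite gt_eqF.
have := h1 _ hsmall; rewrite -zq => h.
have -> : Phi (polexp x y) - Phi z0 - A * z0 * (u +i* v) =
  (Phi (polexp x y) - Phi z0 - A * (z0 * (q - 1))) + A * z0 * (q - 1 - (u +i* v)).
  ring.
rewrite (le_trans (cabsD _ _))// [e]splitr mulrDl lerD//.
  apply: (le_trans h); rewrite cabsM.
  apply: (@le_trans _ _ (e1 * (cabs z0 * (2 * m)))).
    by rewrite ler_pM2l// ler_pM2l.
  by rewrite le_eqVlt; apply/orP; left; apply/eqP; rewrite /e1; field; rewrite gt_eqF.
rewrite (cabsM (A * z0)) (cabsM A z0).
apply: (@le_trans _ _ ((cabs A + 1) * cabs z0 * (e2 * m))).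
  have a0 : 0 <= cabs A * cabs z0 by rewrite mulr_ge0// cabs_ge0.
  have a1 : cabs A * cabs z0 <= (cabs A + 1) * cabs z0.
    by rewrite ler_wpM2r ?cabs_ge0// lerDl.
    exact: (ler_pM a0 (cabs_ge0 _) a1 h2).
rewrite le_eqVlt; apply/orP; left; apply/eqP; rewrite /e2; field.
by rewrite !gt_eqF.
Qed.

Lemma ccontinuous_at_expi Phi r : 0 <= r ->
  (forall z, cabs z = r -> ccontinuous_at Phi z) ->
  ccontinuous (fun t => Phi (r%:C * expi t)).
Proof.
move=> r0 cPhi.
have cg : ccontinuous (fun t => r%:C * expi t).
  apply: ccontinuousM; first exact: ccontinuous_cst.
  by apply: ccontinuous_expi => t; exact: cvg_id.
apply: (ccontinuous_comp cg) => t; apply: cPhi.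
by rewrite cabsM cabs_expi mulr1 cabs_real ger0_norm.
Qed.

(** To be applied to the circle mean as a function of s = ln r, where s = 0 is the exceptional
    circle |z| = 1. *)
Lemma continuous_eq_right (f : R -> R) : continuous f ->
  (forall x y, x < 0 -> y < 0 -> f x = f y) -> (forall x y, 0 < x -> 0 < y -> f x = f y) ->
  forall x y, f x = f y.
Proof.
move=> cf fneg fpos.
have near0 e : 0 < e -> exists2 d : R, 0 < d & forall x, `|x| < d -> `|f 0 - f x| < e.
  move=> e0; have /cvgrPdist_lt /(_ e e0) := cf 0.
  move=> /nbhs_ballP[d /= d0 hd]; exists d => // x xd; apply: hd.
  by rewrite -ball_normE /ball_ /= sub0r normrN.
have lim0 x : (forall d, 0 < d -> exists2 y, `|y| < d & f y = f x) -> f x = f 0.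
  move=> h; apply/esym/eqP; rewrite -subr_eq0 -normr_le0.
  apply/ler_addgt0Pr => e e0; rewrite add0r.
  by have [d d0 hd] := near0 e e0; have [y yd <-] := h d d0; rewrite ltW// hd.
suff h x : f x = f 0 by move=> x y; rewrite h h.
apply: lim0 => d d0; have d2 : `|d / 2| < d by rewrite ger0_norm ?divr_ge0 ?ltW//; lra.
case: (ltgtP x 0) => [x0|x0|->].
- exists (- (d / 2)); rewrite ?normrN//; apply: fneg => //.
  by rewrite oppr_lt0 divr_gt0.
- by exists (d / 2) => //; apply: fpos => //; rewrite divr_gt0.
- by exists 0; rewrite ?normr0.
Qed.

(** Radii on the same side of 1 are joined by a rectangle that avoids s = 0; continuity of the mean
    in s crosses it. The exceptional circle is there for the difference quotient in
    [cauchy_formula1], known only to be continuous at the point 1. *)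
Lemma circle_invariance Phi : (forall z, z != 0 -> ccontinuous_at Phi z) ->
  (forall z, z != 0 -> cabs z != 1 -> cderivable_at Phi z) ->
  forall r1 r2, 0 < r1 -> 0 < r2 ->
  ci 0 (pi *+ 2) (fun t => Phi (r1%:C * expi t)) =
  ci 0 (pi *+ 2) (fun t => Phi (r2%:C * expi t)).
Proof.
move=> cPhi dPhi.
have pi2 : 0 <= (pi : R) *+ 2 by rewrite mulrn_wge0// pi_ge0.
pose H s t := Phi (polexp s t).
have cH : ccontinuous (fun p : R * R => H p.1 p.2).
  apply: (ccontinuous_comp continuous_polexp) => p; apply: cPhi.
  exact: polexp_neq0.
pose psi s := ci 0 (pi *+ 2) (H s).
have psi_eq s1 s2 : s1 <= s2 -> (forall s, s1 <= s <= s2 -> s != 0) -> psi s1 = psi s2.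
  move=> s12 s0; have l0 : 0 <= s2 - s1 by rewrite subr_ge0.
  have := @goursat _ H cH s1 0 (s2 - s1) (pi *+ 2) l0 pi2.
  rewrite (addrC s1) subrK add0r => g.
  have {}g : rect_integral H s1 s2 0 (pi *+ 2) = 0.
    apply: g => s t hs _; apply: rdiff_polexp; apply: dPhi; first exact: polexp_neq0.
    rewrite cabs_polexp -expR0; apply: contra (s0 s hs) => /eqP/expR_inj ->.
    by [].
  have per : ci s1 s2 (H^~ 0) = ci s1 s2 (H^~ (pi *+ 2)).
    by apply: ci_eq => x _; rewrite /H /polexp -[in expi (pi *+ 2)](add0r (pi *+ 2)) expi2pi.
  have aux (X A B : C) : X + 'i * A - X - 'i * B = 0 -> A = B.
    have -> : X + 'i * A - X - 'i * B = 'i * (A - B) by ring.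
    by move/eqP; rewrite mulf_eq0 -cabs_eq0 cabs_i oner_eq0 /= subr_eq0 => /eqP.
  by apply/esym/aux; rewrite -[RHS]g /rect_integral per.
have psi_neg x y : x < 0 -> y < 0 -> psi x = psi y.
  wlog xy : x y / x <= y.
    move=> wl x0 y0; case: (leP x y) => [|/ltW] h; first exact: wl.
    by apply/esym; exact: wl.
  move=> x0 y0; apply: psi_eq => // s /andP[_ sy]; rewrite lt_eqF//.
  exact: le_lt_trans y0.
have psi_pos x y : 0 < x -> 0 < y -> psi x = psi y.
  wlog xy : x y / x <= y.
    move=> wl x0 y0; case: (leP x y) => [|/ltW] h; first exact: wl.
    by apply/esym; exact: wl.
  by move=> x0 y0; apply: psi_eq => // s /andP[xs _]; rewrite gt_eqF// (lt_le_trans x0).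
have psiE x y : psi x = psi y.
  apply/eqP; rewrite eq_complex; apply/andP; split; apply/eqP.
    apply: (@continuous_eq_right (fun s => Re (psi s))).
    - exact: (continuous_rint_param cH.1).
    - by move=> a b a0 b0; rewrite (psi_neg a b).
    - by move=> a b a0 b0; rewrite (psi_pos a b).
  apply: (@continuous_eq_right (fun s => Im (psi s))).
  - exact: (continuous_rint_param cH.2).
  - by move=> a b a0 b0; rewrite (psi_neg a b).
  - by move=> a b a0 b0; rewrite (psi_pos a b).
move=> r1 r2 r10 r20; have := psiE (ln r1) (ln r2).
by rewrite /psi /H /polexp !lnK.
Qed.

(** The mean is independent of the radius and tends to [Phi 0] as the radius shrinks. *)
Lemma circle_mean Phi : (forall z, ccontinuous_at Phi z) ->
  (forall z, z != 0 -> cabs z != 1 -> cderivable_at Phi z) ->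
  forall r, 0 < r ->
  ci 0 (pi *+ 2) (fun t => Phi (r%:C * expi t)) = Phi 0 * (pi *+ 2)%:C.
Proof.
move=> cPhi dPhi r r0.
have pi2 : 0 <= (pi : R) *+ 2 by rewrite mulrn_wge0// pi_ge0.
apply/eqP; rewrite -subr_eq0 -cabs_eq0 eq_le cabs_ge0 andbT.
apply/ler_addgt0Pr => e e0; rewrite add0r.
have e1 : 0 < e / (2 * (pi *+ 2)) by rewrite divr_gt0// mulr_gt0// mulrn_wgt0// pi_gt0.
have [d d0 hd] := cPhi 0 _ e1.
have d2 : 0 < d / 2 by rewrite divr_gt0.
rewrite (circle_invariance (fun z _ => cPhi z) dPhi r0 d2).
rewrite -[X in Phi 0 * X%:C]subr0 -ci_cst// -ciB; last 2 first.
- by apply: ccontinuous_at_expi => //; exact: ltW.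
- exact: ccontinuous_cst.
apply: (@le_trans _ _ (2 * (e / (2 * (pi *+ 2))) * (pi *+ 2 - 0))).
  apply: ci_bound => //.
    apply: ccontinuousB; last exact: ccontinuous_cst.
    by apply: ccontinuous_at_expi => //; exact: ltW.
  move=> t _; apply/ltW/hd; rewrite subr0 cabsM cabs_expi mulr1 cabs_real.
  rewrite ger0_norm ?ltW//; lra.
rewrite subr0 le_eqVlt; apply/orP; left; apply/eqP.
have : 0 < (pi : R) *+ 2 by rewrite mulrn_wgt0// pi_gt0.
by move: (pi *+ 2) => P P0; field; rewrite gt_eqF.
Qed.

End CircleMean.

(** * Fourier coefficients of entire functions *)

Lemma exprVn_mull (K : fieldType) (a b : K) k : a != 0 ->
  b^-1 ^+ k = a ^+ k * (a * b)^-1 ^+ k.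
Proof. by move=> a0; rewrite -exprMn invfM mulrA mulfV// mul1r. Qed.

Section Fourier.
Variable R : realType.
Local Notation C := R[i].
Local Notation tau := ((pi : R) *+ 2).
Implicit Types (F G : C -> C) (g h : R -> C) (r s t x y : R) (z w : C) (k n m : nat).

Lemma tau_gt0 : 0 < tau.
Proof. by rewrite mulrn_wgt0// pi_gt0. Qed.

Lemma tau_ge0 : 0 <= tau.
Proof. exact: ltW tau_gt0. Qed.

Lemma tauC_neq0 : tau%:C != 0 :> C.
Proof. by rewrite (inj_eq (@complexI _)) gt_eqF// tau_gt0. Qed.

Lemma expiN t : expi (- t) = (expi t)^-1 :> C.
Proof.
apply: (mulfI (expi_neq0 t)); rewrite mulfV ?expi_neq0//.
by rewrite -expiD subrr expi0.
Qed.

Lemma ccontinuous_expi1 : ccontinuous (fun t => expi t : C).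
Proof. by apply: ccontinuous_expi => t; exact: cvg_id. Qed.

Lemma ccontinuous_expiN : ccontinuous (fun t => expi (- t) : C).
Proof. by apply: ccontinuous_expi => t; apply: continuousN; exact: cvg_id. Qed.

Lemma ci_sum a b n (g : nat -> R -> C) : (forall k, ccontinuous (g k)) ->
  ci a b (fun t => \sum_(k < n) g k t) = \sum_(k < n) ci a b (g k).
Proof.
move=> cg; elim: n => [|n IHn].
  rewrite big_ord0; under [X in ci a b X]eq_fun do rewrite big_ord0.
  rewrite -[RHS](mul0r (ci a b (fun=> 0))) -(ciZ _ _ _ (ccontinuous_cst R (0 : C))).
  by apply: ci_eq => t _; rewrite mul0r.
rewrite big_ord_recr /= -IHn -ciD//; first by apply: ci_eq => t _; rewrite big_ord_recr.
elim: n {IHn} => [|n IHn].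
  by under [X in ccontinuous X]eq_fun do rewrite big_ord0; exact: ccontinuous_cst.
by under [X in ccontinuous X]eq_fun do rewrite big_ord_recr; exact: ccontinuousD.
Qed.

Lemma ci_conj a b g : ccontinuous g -> ci a b (fun t => (g t)^*) = (ci a b g)^*.
Proof.
move=> [g1 g2]; rewrite /ci /=; apply/eqP; rewrite eq_complex /=.
rewrite -mulN1r -rintZ//; apply/andP; split; apply/eqP; congr rint; apply/funext => t /=.
  by case: (g t).
by case: (g t) => u v /=; rewrite mulN1r.
Qed.

Lemma ci_periodic_shift g th : ccontinuous g -> (forall t, g (t + tau) = g t) ->
  ci 0 tau (fun t => g (t + th)) = ci 0 tau g.
Proof.
move=> [g1 g2] gT; rewrite /ci; congr (_ +i* _).
  apply: (rint_periodic_shift _ g1) => [|t]; first exact: tau_ge0.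
  by rewrite /= gT.
apply: (rint_periodic_shift _ g2) => [|t]; first exact: tau_ge0.
by rewrite /= gT.
Qed.

Lemma entire_continuous F : entire F -> forall z, ccontinuous_at F z.
Proof. by move=> eF z; apply: cderivable_continuous; exact: eF. Qed.

Lemma entire_id : entire (fun z : C => z).
Proof. by move=> z; exact: derivable_id. Qed.

Lemma entire_cst (c : C) : entire (fun _ : C => c).
Proof. by move=> z; exact: (@derivable_cst C C^o C^o c z 1). Qed.

Lemma cderivableM F G z : cderivable_at F z -> cderivable_at G z ->
  cderivable_at (fun w => F w * G w) z.
Proof. by move=> dF dG; exact: (@derivableM C C^o F G z 1 dF dG). Qed.

Lemma cderivableV F z : F z != 0 -> cderivable_at F z ->
  cderivable_at (fun w => (F w)^-1) z.
Proof. by move=> F0 dF; exact: (@derivableV C C^o F z 1 F0 dF). Qed.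

Lemma cderivableD F G z : cderivable_at F z -> cderivable_at G z ->
  cderivable_at (fun w => F w + G w) z.
Proof. by move=> dF dG; exact: (@derivableD C C^o C^o F G z 1 dF dG). Qed.

Lemma cderivableX F z n : cderivable_at F z -> cderivable_at (fun w => F w ^+ n) z.
Proof.
move=> dF; elim: n => [|n IHn]; first exact: entire_cst.
by under [X in cderivable_at X]eq_fun do rewrite exprS; exact: cderivableM.
Qed.

Lemma entire_horner (p : {poly C}) : entire (fun z => p.[z]).
Proof.
elim/poly_ind : p => [|p c IHp].
  by under [X in entire X]eq_fun do rewrite horner0; exact: entire_cst.
under [X in entire X]eq_fun do rewrite hornerMXaddC.
move=> z; apply: cderivableD; last exact: entire_cst.
by apply: cderivableM; [exact: IHp|exact: entire_id].
Qed.

Lemma entire_exprn n : entire (fun z : C => z ^+ n).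
Proof. by move=> z; apply: cderivableX; exact: entire_id. Qed.

Lemma cderivable_near F G z (d : R) : 0 < d ->
  (forall w, cabs (w - z) < d -> F w = G w) -> cderivable_at F z -> cderivable_at G z.
Proof.
move=> d0 FG /cderivableP[A hA]; apply/cderivableP; exists A => e e0.
have [d' d'0 hd'] := hA e e0; exists (Num.min d d'); first by rewrite lt_min d0.
move=> h; rewrite lt_min => /andP[h1 h2].
by rewrite -!FG ?hd'// ?subrr ?cabs0// addrAC subrr add0r.
Qed.

Lemma entire_scale F (c : C) : entire F -> entire (fun w => F (c * w)).
Proof.
move=> eF w; have /cderivableP[A hA] := eF (c * w).
apply/cderivableP; exists (A * c) => e e0.
have c1 : 0 < cabs c + 1 by rewrite ltr_wpDl ?cabs_ge0.
have e1 : 0 < e / (cabs c + 1) by rewrite divr_gt0.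
have [d d0 hd] := hA _ e1; exists (d / (cabs c + 1)); first by rewrite divr_gt0.
move=> h; rewrite ltr_pdivlMr// => hh.
have ch : cabs (c * h) <= cabs h * (cabs c + 1).
  by rewrite cabsM mulrC ler_wpM2l ?cabs_ge0// lerDl.
rewrite mulrDr -(mulrA A); apply: (le_trans (hd (c * h) (le_lt_trans ch hh))).
apply: (@le_trans _ _ (e / (cabs c + 1) * (cabs h * (cabs c + 1)))).
  by rewrite ler_pM2l.
by rewrite mulrCA divfK ?gt_eqF// mulrC.
Qed.

Lemma ccontinuous_circle F z : (forall w, ccontinuous_at F w) ->
  ccontinuous (fun t => F (z * expi t)).
Proof.
move=> cF; have cg : ccontinuous (fun t => z * expi t).
  by apply: ccontinuousM; [exact: ccontinuous_cst|exact: ccontinuous_expi1].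
exact: (ccontinuous_comp cg (fun t => cF _)).
Qed.

Lemma ci_expiX k : (0 < k)%N -> ci 0 tau (fun t => expi t ^+ k) = 0 :> C.
Proof.
move=> k0; have := @circle_mean _ (fun z => z ^+ k) _ _ 1 ltr01.
rewrite expr0n (gtn_eqF k0) /= mul0r => <-.
- by apply: ci_eq => t _; rewrite mul1r.
- by apply: entire_continuous; exact: entire_exprn.
- by move=> z _ _; exact: entire_exprn.
Qed.

Lemma expi_conj t : expi (- t) = (expi t)^* :> C.
Proof. by rewrite /expi cosN sinN. Qed.

Lemma ci_expiNX k : (0 < k)%N -> ci 0 tau (fun t => expi (- t) ^+ k) = 0 :> C.
Proof.
move=> k0; rewrite -[RHS]conjc0 -(ci_expiX k0) -ci_conj.
  by apply: ci_eq => t _; rewrite expi_conj rmorphXn.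
by apply: ccontinuousX; exact: ccontinuous_expi1.
Qed.

Lemma expiNK t : expi t * expi (- t) = 1 :> C.
Proof. by rewrite expiN mulfV// expi_neq0. Qed.

Lemma ci_orthogonal m k :
  ci 0 tau (fun t => expi t ^+ m * expi (- t) ^+ k) = (m == k)%:R * tau%:C :> C.
Proof.
case: (ltngtP m k) => [mk|km|->].
- rewrite mul0r -(@ci_expiNX (k - m)) ?subn_gt0//; apply: ci_eq => t _.
  by rewrite -[in LHS](subnKC (ltnW mk)) exprD mulrA -exprMn expiNK expr1n mul1r.
- rewrite mul0r -(@ci_expiX (m - k)) ?subn_gt0//; apply: ci_eq => t _.
  by rewrite -[in LHS](subnK (ltnW km)) exprD -mulrA -exprMn expiNK expr1n mulr1.
- rewrite -[tau in RHS]subr0 -(ci_cst _ tau_ge0); apply: ci_eq => t _.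
  by rewrite -exprMn expiNK expr1n.
Qed.

(** A Fourier coefficient on the unit circle; for entire F it is the k-th Taylor coefficient, and
    [fourier_coef] shows that other circles give the same number. *)
Definition coef F k : C := ci 0 tau (fun t => F (expi t) * expi (- t) ^+ k) / tau%:C.

Lemma coef_tau F k :
  coef F k * tau%:C = ci 0 tau (fun t => F (expi t) * expi (- t) ^+ k).
Proof. by rewrite /coef; exact: (divfK tauC_neq0). Qed.

Lemma ccontinuous_fourier F z k : (forall w, ccontinuous_at F w) ->
  ccontinuous (fun t => F (z * expi t) * expi (- t) ^+ k).
Proof.
move=> cF; apply: ccontinuousM; first exact: ccontinuous_circle.
by apply: ccontinuousX; exact: ccontinuous_expiN.
Qed.

Lemma coef_eq_at0 F : entire F -> coef F 0 = F 0.
Proof.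
move=> eF; have := @circle_mean _ F (entire_continuous eF) (fun z _ _ => eF z) 1 ltr01.
move=> h; apply: (mulIf tauC_neq0); rewrite coef_tau -h.
by apply: ci_eq => t _; rewrite mul1r mulr1.
Qed.

(** [circle_invariance] for F(w) w^(-k), holomorphic off 0, moves the circle of radius |z| to the
    unit circle; a shift of t by the argument of z then turns |z| into z. *)
Lemma fourier_coef F z k : entire F ->
  ci 0 tau (fun t => F (z * expi t) * expi (- t) ^+ k) = coef F k * z ^+ k * tau%:C.
Proof.
move=> eF; have cF := entire_continuous eF.
have [->|z0] := eqVneq z 0.
  case: k => [|k].
    rewrite coef_eq_at0// mulr1 -[tau in RHS]subr0 -(ci_cst _ tau_ge0).
    by apply: ci_eq => t _; rewrite mul0r mulr1.
  rewrite expr0n mulr0 mul0r.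
  transitivity (F 0 * ci 0 tau (fun t => expi (- t) ^+ k.+1)); last first.
    by rewrite ci_expiNX// mulr0.
  rewrite -ciZ; first by apply: ci_eq => t _; rewrite mul0r.
  by apply: ccontinuousX; exact: ccontinuous_expiN.
have [th zE] := polar z; have r0 : 0 < cabs z by rewrite cabs_gt0.
pose Phi w := F w * (w^-1) ^+ k.
have dPhi w : w != 0 -> cderivable_at Phi w.
  move=> w0; apply: cderivableM; first exact: eF.
  apply: (@cderivableX (fun w => w^-1)).
  by apply: (@cderivableV (fun w => w)) => //; exact: entire_id.
have cPhi w : w != 0 -> ccontinuous_at Phi w.
  by move=> w0; apply: cderivable_continuous; exact: dPhi.
have inv := circle_invariance cPhi (fun w hw _ => dPhi w hw) r0 ltr01.
have E1 : ci 0 tau (fun t => Phi (1%:C * expi t)) = coef F k * tau%:C.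
  by rewrite coef_tau; apply: ci_eq => t _; rewrite /Phi mul1r expiN.
have cg : ccontinuous (fun t => Phi ((cabs z)%:C * expi t)).
  apply: ccontinuous_at_expi => [|w wz]; first exact: ltW.
  by apply: cPhi; rewrite -cabs_gt0 wz.
have per t : Phi ((cabs z)%:C * expi (t + tau)) = Phi ((cabs z)%:C * expi t).
  by rewrite expi2pi.
have h := etrans (ci_periodic_shift th cg per) (etrans inv E1).
rewrite mulrAC -h mulrC -ciZ; last first.
  have cs : continuous (fun t => t + th).
    by move=> t; apply: cvgD; [exact: cvg_id|exact: cvg_cst].
  by split=> t; [exact: (continuous_comp (cs t) (cg.1 _))|
    exact: (continuous_comp (cs t) (cg.2 _))].
apply: ci_eq => t _; rewrite /Phi expiD mulrCA.
have -> : (cabs z)%:C * (expi t * expi th) = z * expi t.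
  by rewrite [in RHS]zE mulrAC -mulrA.
by rewrite expiN (exprVn_mull _ _ z0).
Qed.

Lemma ccontinuous_atM F G z : ccontinuous_at F z -> ccontinuous_at G z ->
  ccontinuous_at (fun w => F w * G w) z.
Proof.
move=> cF cG e e0.
have G1 : 0 < cabs (G z) + 1 by rewrite ltr_wpDl ?cabs_ge0.
have F1 : 0 < cabs (F z) + 1 by rewrite ltr_wpDl ?cabs_ge0.
have eG : 0 < e / 2 / (cabs (G z) + 1) by rewrite !divr_gt0.
have eF : 0 < e / 2 / (cabs (F z) + 1) by rewrite !divr_gt0.
have [d1 d10 h1] := cF _ eG; have [d2 d20 h2] := cG _ eF.
have [d3 d30 h3] := cG 1 ltr01.
exists (Num.min d1 (Num.min d2 d3)); first by rewrite !lt_min d10 d20.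
move=> w; rewrite !lt_min => /and3P[/h1 {}h1 /h2 {}h2 /h3 {}h3].
have -> : F w * G w - F z * G z = (F w - F z) * G w + F z * (G w - G z) by ring.
rewrite (le_lt_trans (cabsD _ _))// !cabsM [e]splitr ltr_leD//.
  apply: (@le_lt_trans _ _ (cabs (F w - F z) * (cabs (G z) + 1))).
    rewrite ler_wpM2l ?cabs_ge0// -lerBlDl.
    by rewrite ltW// (le_lt_trans (cabs_lebD _ _)).
  by rewrite -ltr_pdivlMr.
apply: (@le_trans _ _ ((cabs (F z) + 1) * cabs (G w - G z))).
  by rewrite ler_wpM2r ?cabs_ge0// lerDl.
by rewrite mulrC -ler_pdivlMr// ltW.
Qed.

End Fourier.

(** * Cauchy's formula *)

Lemma geom_step (K : fieldType) (a : K) n : 1 - a != 0 ->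
  a ^+ n / (1 - a) = a ^+ n + a ^+ n.+1 / (1 - a).
Proof. by move=> a1; rewrite exprS; field. Qed.

Lemma small_pow2 (R : realType) (K e : R) : 0 < e ->
  exists N, forall n, (N <= n)%N -> K / 2 ^+ n <= e.
Proof.
move=> e0; exists (Num.truncn (K / e)).+1 => n Nn.
rewrite ler_pdivrMr ?exprn_gt0// -ler_pdivrMl// mulrC.
apply: (le_trans (ltW (truncnS_gt _))).
by rewrite -natrX ler_nat (leq_trans Nn)// ltnW// ltn_expl.
Qed.

Section CauchyFormula.
Variable R : realType.
Local Notation C := R[i].
Local Notation tau := ((pi : R) *+ 2).
Implicit Types (F G : C -> C) (g h : R -> C) (r s t x y : R) (z w : C) (k n m : nat).

(** With w = 2 z e^(it) and u = z/w = e^(-it)/2, the factor 1/(1 - u) = w/(w - z) is Cauchy's kernel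
    with respect to dt, and u^n/(1 - u) is what remains of its geometric series after n terms. *)
Definition cker n t : C := (expi (- t) / 2) ^+ n / (1 - expi (- t) / 2).

Lemma natC (n : nat) : (n%:R : C) = (n%:R : R)%:C.
Proof. by rewrite rmorph_nat. Qed.

Lemma cabs_half t : cabs (expi (- t) / 2 : C) = 2^-1.
Proof. by rewrite cabsM cabs_expi mul1r cabsV natC cabs_real ger0_norm. Qed.

Lemma cker_den_ge t : 2^-1 <= cabs (1 - expi (- t) / 2 : C).
Proof. by have := cabs_lebD 1 (expi (- t) / 2 : C); rewrite cabs1 cabs_half; lra. Qed.

Lemma cker_den_neq0 t : 1 - expi (- t) / 2 != 0 :> C.
Proof. by rewrite -cabs_gt0 (lt_le_trans _ (cker_den_ge t)). Qed.

Lemma ccontinuous_half : ccontinuous (fun t => expi (- t) / 2 : C).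
Proof. by apply: ccontinuousM; [exact: ccontinuous_expiN|exact: ccontinuous_cst]. Qed.

Lemma ccontinuous_cker n : ccontinuous (cker n).
Proof.
apply: ccontinuousM; first by apply: ccontinuousX; exact: ccontinuous_half.
have cd : ccontinuous (fun t => 1 - expi (- t) / 2 : C).
  by apply: ccontinuousB; [exact: ccontinuous_cst|exact: ccontinuous_half].
apply: (ccontinuous_comp (F := fun w => w^-1) cd) => t.
by apply: ccontinuous_atV; exact: cker_den_neq0.
Qed.

Lemma cabs_cker n t : cabs (cker n t) <= 2 / 2 ^+ n.
Proof.
rewrite cabsM cabsX cabs_half cabsV exprVn mulrC ler_pM2r ?invr_gt0 ?exprn_gt0//.
by rewrite -[2 in leRHS]invrK lef_pV2 ?posrE ?cker_den_ge// cabs_gt0 cker_den_neq0.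
Qed.

Lemma ckerS n t : cker n t = (expi (- t) / 2) ^+ n + cker n.+1 t.
Proof. exact: (geom_step _ (cker_den_neq0 t)). Qed.

Lemma cker_step F z n : entire F ->
  ci 0 tau (fun t => F (2 * z * expi t) * cker n t) =
  coef F n * z ^+ n * tau%:C + ci 0 tau (fun t => F (2 * z * expi t) * cker n.+1 t).
Proof.
move=> eF; have cF := entire_continuous eF.
have -> : coef F n * z ^+ n * tau%:C =
    ci 0 tau (fun t => F (2 * z * expi t) * (expi (- t) / 2) ^+ n).
  transitivity ((2^-1 : C) ^+ n * ci 0 tau (fun t => F (2 * z * expi t) * expi (- t) ^+ n)).
    rewrite fourier_coef// exprMn exprVn; field.
    by rewrite expf_neq0//.
  rewrite -ciZ; last exact: ccontinuous_fourier.
  by apply: ci_eq => t _; rewrite [in RHS]exprMn; ring.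
rewrite -ciD; first by apply: ci_eq => t _; rewrite ckerS mulrDr.
- apply: ccontinuousM; first exact: ccontinuous_circle.
  by apply: ccontinuousX; exact: ccontinuous_half.
- by apply: ccontinuousM; [exact: ccontinuous_circle|exact: ccontinuous_cker].
Qed.

Definition psum (b : nat -> C) n z : C := \sum_(k < n) b k * z ^+ k.

Lemma psumS b n z : psum b n.+1 z = psum b n z + b n * z ^+ n.
Proof. by rewrite /psum big_ord_recr. Qed.

Lemma cker_psum F z n : entire F ->
  ci 0 tau (fun t => F (2 * z * expi t) * cker 0 t) =
  psum (coef F) n z * tau%:C + ci 0 tau (fun t => F (2 * z * expi t) * cker n t).
Proof.
move=> eF; elim: n => [|n IHn]; first by rewrite /psum big_ord0 mul0r add0r.
by rewrite IHn (cker_step z n eF) psumS (mulrDl (psum _ _ _)) addrA.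
Qed.

(** In the geometric series of the kernel only the constant term has a nonzero integral, and the
    remainder is O(2^-n). *)
Lemma ci_cker0 : ci 0 tau (cker 0) = tau%:C.
Proof.
have cE n : ci 0 tau (cker 0) = tau%:C + ci 0 tau (cker n.+1).
  elim: n => [|n ->].
    have -> : tau%:C = ci 0 tau (fun t => (expi (- t) / 2) ^+ 0) :> C.
      by rewrite ci_cst ?tau_ge0// subr0 mul1r.
    rewrite -ciD; first by apply: ci_eq => t _; exact: ckerS.
      by apply: ccontinuousX; exact: ccontinuous_half.
    exact: ccontinuous_cker.
  congr (_ + _); rewrite -[RHS]add0r.
  have -> : 0 = ci 0 tau (fun t => (expi (- t) / 2) ^+ n.+1) :> C.
    transitivity ((2^-1 : C) ^+ n.+1 * ci 0 tau (fun t => expi (- t) ^+ n.+1)).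
      by rewrite ci_expiNX// mulr0.
    rewrite -ciZ; last by apply: ccontinuousX; exact: ccontinuous_expiN.
    by apply: ci_eq => t _; rewrite [in RHS]exprMn mulrC.
  rewrite -ciD; first by apply: ci_eq => t _; exact: ckerS.
    by apply: ccontinuousX; exact: ccontinuous_half.
  exact: ccontinuous_cker.
apply/eqP; rewrite -subr_eq0 -cabs_eq0 eq_le cabs_ge0 andbT.
apply/ler_addgt0Pr => e e0; rewrite add0r.
have tau0 := tau_gt0 R.
have [n hn] := small_pow2 (2 * 2 * tau) e0.
rewrite (cE n) addrAC subrr add0r.
apply: (le_trans (ci_bound (tau_ge0 R) (ccontinuous_cker _) (fun t _ => cabs_cker n.+1 t))).
have -> : 2 * (2 / 2 ^+ n.+1) * (tau - 0) = 2 * 2 * tau / 2 ^+ n.+1 by ring.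
by apply: hn.
Qed.

(** The general point follows from w -> F(z w); normalizing it to 1 keeps the singularity on the
    fixed exceptional circle |w| = 1. *)
Lemma cauchy_formula1 G : entire G ->
  ci 0 tau (fun t => G (2 * expi t) * cker 0 t) = G 1 * tau%:C.
Proof.
move=> eG; have cG := entire_continuous eG.
have /cderivableP[A hA] := eG 1.
(* The difference quotient at 1, completed by the derivative [A]: continuous at 1, differentiable
   elsewhere. *)
pose K w := if w == 1 then A else (G w - G 1) * (w - 1)^-1.
have dK w : w != 1 -> cderivable_at K w.
  move=> w1; have w1' : 0 < cabs (w - 1) by rewrite cabs_gt0 subr_eq0.
  apply: (@cderivable_near _ (fun w => (G w - G 1) * (w - 1)^-1) K w _ w1').
    move=> v vw; rewrite /K; case: eqP => // v1; move: vw.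
    by rewrite v1 cabs_distC ltxx.
  apply: cderivableM.
    by apply: cderivableD; [exact: eG|exact: entire_cst].
  apply: (@cderivableV _ (fun w => w - 1)); first by rewrite subr_eq0.
  by apply: cderivableD; [exact: entire_id|exact: entire_cst].
have cK w : ccontinuous_at K w.
  have [->|w1] := eqVneq w 1; last by apply: cderivable_continuous; exact: dK.
  move=> e e0; have e2 : 0 < e / 2 by rewrite divr_gt0.
  have [d d0 hd] := hA _ e2; exists d => // v vd; rewrite /K eqxx.
  case: eqP => [_|/eqP v1]; first by rewrite subrr cabs0.
  have v0 : v - 1 != 0 by rewrite subr_eq0.
  have := hd _ vd; rewrite (addrC 1 (v - 1)) subrK => h.
  have -> : (G v - G 1) * (v - 1)^-1 - A = (G v - G 1 - A * (v - 1)) / (v - 1).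
    by field.
  rewrite cabsM cabsV ltr_pdivrMr ?cabs_gt0// (le_lt_trans h)//.
  by rewrite ltr_pM2r ?cabs_gt0//; lra.
(* [w * K w] vanishes at 0, so its mean over |w| = 2 is 0. On that circle w/(w - 1) is [cker 0 t],
   so the mean is that of (G(w) - G(1)) [cker 0 t]. *)
have := @circle_mean _ (fun w => w * K w) _ _ 2 (ltr0n _ 2).
rewrite mul0r mul0r => h0.
have {}h0 : ci 0 tau (fun t => 2%:C * expi t * K (2%:C * expi t)) = 0.
  apply: h0.
  - by move=> w; apply: ccontinuous_atM; [exact: (entire_continuous (@entire_id R))|exact: cK].
  - move=> w _ w1; apply: cderivableM; first exact: entire_id.
    by apply: dK; apply: contra w1 => /eqP ->; rewrite cabs1.
rewrite -ci_cker0 -ciZ; last exact: ccontinuous_cker.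
apply/eqP; rewrite -subr_eq0 -ciB; last 2 first.
- by apply: ccontinuousM; [exact: ccontinuous_circle|exact: ccontinuous_cker].
- by apply: ccontinuousM; [exact: ccontinuous_cst|exact: ccontinuous_cker].
apply/eqP; rewrite -[RHS]h0; apply: ci_eq => t _.
rewrite -[2%:C]natC /K; have d0 : 2 * expi t - 1 != 0 :> C.
  rewrite -cabs_gt0; have := cabs_lebD (2 * expi t : C) 1.
  by rewrite cabsM cabs_expi natC cabs_real cabs1 ger0_norm//; lra.
rewrite -subr_eq0 (negbTE d0) /cker expr0 expiN -mulrBl.
have e0 : expi t != 0 :> C by exact: expi_neq0.
field.
by rewrite e0 d0.
Qed.

Lemma cauchy_formula F z : entire F ->
  ci 0 tau (fun t => F (2 * z * expi t) * cker 0 t) = F z * tau%:C.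
Proof.
move=> eF; have := cauchy_formula1 (@entire_scale _ F z eF); rewrite mulr1 => <-.
by apply: ci_eq => t _; rewrite mulrA (mulrC 2).
Qed.

Lemma entire_tail F z n : entire F ->
  F z - psum (coef F) n z = tau%:C^-1 * ci 0 tau (fun t => F (2 * z * expi t) * cker n t).
Proof.
move=> eF; apply: (mulIf (tauC_neq0 R)); rewrite mulrBl -cauchy_formula// (cker_psum _ n eF).
by rewrite addrAC subrr add0r mulrAC mulVf ?tauC_neq0// mul1r.
Qed.

Lemma coef_bound F r (M : R) k : entire F -> 0 < r ->
  (forall w, cabs w = r -> cabs (F w) <= M) -> cabs (coef F k) * r ^+ k <= 2 * M.
Proof.
move=> eF r0 FM; have cF := entire_continuous eF.
have := fourier_coef r%:C k eF => /(congr1 (@cabs R)).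
rewrite !cabsM cabsX !cabs_real (gtr0_norm r0) (gtr0_norm (tau_gt0 R)) => h.
rewrite -(ler_pM2r (tau_gt0 R)) -h -[X in _ <= _ * X]subr0.
apply: ci_bound; [exact: tau_ge0|exact: ccontinuous_fourier|move=> t _].
rewrite cabsM cabsX cabs_expi expr1n mulr1; apply: FM.
by rewrite cabsM cabs_expi cabs_real mulr1 gtr0_norm.
Qed.

Lemma entire_tail_bound F z (M : R) n : entire F ->
  (forall w, cabs w = 2 * cabs z -> cabs (F w) <= M) ->
  cabs (F z - psum (coef F) n z) <= 4 * M / 2 ^+ n.
Proof.
move=> eF FM; rewrite entire_tail// cabsM cabsV cabs_real (gtr0_norm (tau_gt0 R)).
have cF := entire_continuous eF.
rewrite mulrC ler_pdivrMr ?tau_gt0//.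
have -> : 4 * M / 2 ^+ n * tau = 2 * (M * (2 / 2 ^+ n)) * (tau - 0) by ring.
apply: ci_bound; first exact: tau_ge0.
  by apply: ccontinuousM; [exact: ccontinuous_circle|exact: ccontinuous_cker].
move=> t _; rewrite cabsM; apply: ler_pM; rewrite ?cabs_ge0 ?cabs_cker//.
by apply: FM; rewrite !cabsM cabs_expi mulr1 natC cabs_real ger0_norm.
Qed.

Lemma coef_psum b n k : (k < n)%N -> coef (psum b n) k = b k.
Proof.
move=> kn; rewrite /coef; apply: (mulIf (tauC_neq0 R)); rewrite divfK ?tauC_neq0//.
transitivity (\sum_(j < n) b j * ci 0 tau (fun t => expi t ^+ j * expi (- t) ^+ k)).
  have cj (j : nat) : ccontinuous (fun t => expi t ^+ j * expi (- t) ^+ k : C).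
    by apply: ccontinuousM; apply: ccontinuousX;
      [exact: ccontinuous_expi1|exact: ccontinuous_expiN].
  under [RHS]eq_bigr do rewrite -ciZ//.
  rewrite -(@ci_sum _ _ _ n (fun j t => b j * (expi t ^+ j * expi (- t) ^+ k))).
    by apply: ci_eq => t _; rewrite mulr_suml; apply: eq_bigr => j _; rewrite mulrA.
  by move=> j; apply: ccontinuousM => //; exact: ccontinuous_cst.
rewrite (bigD1 (Ordinal kn)) //= big1 ?addr0; first by rewrite ci_orthogonal eqxx mul1r.
move=> j jk; rewrite ci_orthogonal; case: eqP => [jk'|]; last by rewrite mul0r mulr0.
by exfalso; move/eqP: jk; apply; exact: val_inj.
Qed.

Lemma entire_psum b n : entire (psum b n).
Proof.
elim: n => [|n IHn].
  under [X in entire X]eq_fun do rewrite /psum big_ord0; exact: entire_cst.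
under [X in entire X]eq_fun do rewrite /psum big_ord_recr.
move=> z; apply: cderivableD; first exact: IHn.
by apply: cderivableM; [exact: entire_cst|exact: entire_exprn].
Qed.

Lemma ccontinuous_fourier1 F k : (forall w, ccontinuous_at F w) ->
  ccontinuous (fun t => F (expi t) * expi (- t) ^+ k).
Proof.
move=> cF; apply: ccontinuousM; last by apply: ccontinuousX; exact: ccontinuous_expiN.
exact: (ccontinuous_comp (@ccontinuous_expi1 R) (fun t => cF _)).
Qed.

(** Uniform convergence on the unit circle permits termwise integration against e^(-ikt). *)
Lemma coef_unique F b (M : R) : entire F ->
  (forall n z, cabs z = 1 -> cabs (F z - psum b n z) <= M / 2 ^+ n) ->
  coef F =1 b.
Proof.
move=> eF hb k; have cF := entire_continuous eF; have t0 := tau_gt0 R.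
have M0 : 0 <= M.
  have := hb 0%N 1 (cabs1 R); rewrite expr0 divr1; apply: le_trans; exact: cabs_ge0.
apply/eqP; rewrite -subr_eq0 -cabs_eq0 eq_le cabs_ge0 andbT.
apply/ler_addgt0Pr => e e0; rewrite add0r.
(* The index must exceed [k] for the partial sum to contain the k-th term. *)
have [N hN] := small_pow2 (2 * M) e0; pose n := (maxn k N).+1.
rewrite -(@coef_psum b n k) ?ltnS ?leq_maxl//.
rewrite /coef -mulrBl -ciB; last 2 first.
- exact: ccontinuous_fourier1.
- exact: (ccontinuous_fourier1 _ (entire_continuous (@entire_psum b n))).
rewrite cabsM cabsV cabs_real gtr0_norm// ler_pdivrMr//.
apply: (@le_trans _ _ (2 * (M / 2 ^+ n) * (tau - 0))).
  apply: ci_bound; first exact: tau_ge0.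
    apply: ccontinuousB; first exact: ccontinuous_fourier1.
    exact: (ccontinuous_fourier1 _ (entire_continuous (@entire_psum b n))).
  move=> t _; rewrite -mulrBl cabsM cabsX cabs_expi expr1n mulr1.
  by apply: hb; rewrite cabs_expi.
rewrite subr0 ler_pM2r// mulrA; apply: hN.
by rewrite ltnW// ltnS leq_maxr.
Qed.

End CauchyFormula.

(** * Power series *)

Section PowerSeries.
Variable R : realType.
Local Notation C := R[i].
Implicit Types (F G : C -> C) (r s t x y : R) (z w h : C) (k n m : nat) (b : nat -> C).

(** The intervals [u n - e n, u n + e n] meet pairwise, so the supremum of their left ends lies in
    all of them, and the rate [e] survives in the limit. *)
Lemma real_limit (u e : nat -> R) :
  (forall n m, (n <= m)%N -> `|u m - u n| <= e n) -> exists l, forall n, `|l - u n| <= e n.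
Proof.
move=> ue.
have h n m : u n - e n <= u m + e m.
  have := ue _ _ (leq_maxl n m); have := ue _ _ (leq_maxr n m).
  rewrite !ler_norml => /andP[h1 h2] /andP[h3 h4]; lra.
have hs : has_sup (range (fun n => u n - e n)).
  by split; [exists (u 0%N - e 0%N), 0%N|exists (u 0%N + e 0%N) => _ [n _ <-]].
exists (sup (range (fun n => u n - e n))) => n.
have h1 : u n - e n <= sup (range (fun n => u n - e n)).
  by apply: ub_le_sup; [exact: hs.2|exists n].
have h2 : sup (range (fun n => u n - e n)) <= u n + e n.
  by apply: ge_sup; [exact: hs.1|move=> _ [m _ <-]].
rewrite ler_norml; apply/andP; split; lra.
Qed.

Lemma complex_limit (u : nat -> C) (e : nat -> R) :
  (forall n m, (n <= m)%N -> cabs (u m - u n) <= e n) ->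
  exists l, forall n, cabs (l - u n) <= 2 * e n.
Proof.
move=> ue.
have [|x hx] := @real_limit (fun n => Re (u n)) e.
  by move=> n m /ue; apply: le_trans; rewrite -raddfB ler_Re_cabs.
have [|y hy] := @real_limit (fun n => Im (u n)) e.
  by move=> n m /ue; apply: le_trans; rewrite -raddfB ler_Im_cabs.
exists (x +i* y) => n; apply: (le_trans (cabs_le_ReIm _)).
by rewrite mulr_natl mulr2n !raddfB lerD//=.
Qed.

(** The bound is the exact difference of geometric tails, which lets the induction on [m] close. *)
Lemma geom_partial_sum (a : nat -> C) (M : R) n m :
  (forall k, cabs (a k) <= M / 2 ^+ k) -> (n <= m)%N ->
  cabs (\sum_(k < m) a k - \sum_(k < n) a k) <= 2 * M / 2 ^+ n - 2 * M / 2 ^+ m.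
Proof.
move=> aM /subnKC <-; elim: (m - n)%N => [|d IHd].
  by rewrite addn0 !subrr cabs0.
rewrite addnS big_ord_recr /= addrAC (le_trans (cabsD _ _))//.
have -> : 2 * M / 2 ^+ n - 2 * M / 2 ^+ (n + d).+1 =
  (2 * M / 2 ^+ n - 2 * M / 2 ^+ (n + d)) + M / 2 ^+ (n + d).
  by rewrite exprS; field; rewrite !expf_neq0.
exact: lerD.
Qed.

Lemma geom_limit (a : nat -> C) (M : R) : (forall k, cabs (a k) <= M / 2 ^+ k) ->
  exists l, forall n, cabs (l - \sum_(k < n) a k) <= 4 * M / 2 ^+ n.
Proof.
move=> aM; have M0 : 0 <= M.
  by have := aM 0%N; rewrite expr0 divr1; apply: le_trans; exact: cabs_ge0.
have [|l hl] := @complex_limit (fun n => \sum_(k < n) a k) (fun n => 2 * M / 2 ^+ n).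
  move=> n m nm; apply: (le_trans (geom_partial_sum aM nm)).
  by rewrite gerDl oppr_le0 divr_ge0 ?exprn_ge0// mulr_ge0.
by exists l => n; apply: (le_trans (hl n)); rewrite !mulrA -natrM.
Qed.

Lemma exprD_taylor_bound z h k : cabs h <= 1 ->
  cabs ((z + h) ^+ k - z ^+ k - k%:R * z ^+ k.-1 * h) <= cabs h ^+ 2 * (cabs z + 1) ^+ k.
Proof.
move=> h1; set a := cabs z; have a0 : 0 <= a by exact: cabs_ge0.
(* The bracket is the left-hand side at [z = a], [h = 1], so both sides obey the
   same recursion in [k]. *)
suff H : cabs ((z + h) ^+ k - z ^+ k - k%:R * z ^+ k.-1 * h) <=
    cabs h ^+ 2 * ((a + 1) ^+ k - a ^+ k - k%:R * a ^+ k.-1).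
  apply: (le_trans H); rewrite ler_wpM2l ?exprn_ge0 ?cabs_ge0//.
  by rewrite -addrA gerDl -opprD oppr_le0 addr_ge0 ?mulr_ge0 ?exprn_ge0.
elim: k => [|k IHk].
  by rewrite !expr0 !subrr !mul0r !subr0 cabs0 mulr0.
have step (K : comPzRingType) (x y : K) :
   (x + y) ^+ k.+1 - x ^+ k.+1 - k.+1%:R * x ^+ k * y =
   k%:R * x ^+ k.-1 * y ^+ 2 + (x + y) * ((x + y) ^+ k - x ^+ k - k%:R * x ^+ k.-1 * y).
  case: k {IHk} => [|j] /=; first by rewrite !expr0 !expr1; ring.
  by rewrite !exprS -!natr1; ring.
rewrite /= step (le_trans (cabsD _ _))//.
have stepR := step R a 1; rewrite !mulr1 expr1n mulr1 in stepR.
rewrite stepR [leRHS]mulrDr lerD//.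
  rewrite !cabsM !cabsX natC cabs_real ger0_norm// mulrC -/a.
  by [].
rewrite cabsM mulrCA ler_pM ?cabs_ge0//.
by rewrite (le_trans (cabsD _ _))// lerD2l.
Qed.

Lemma power_series b : (forall r, 0 < r -> exists M : R, forall k, cabs (b k) * r ^+ k <= M) ->
  exists F, entire F /\ forall (r M : R), 0 < r ->
    (forall k, cabs (b k) * (2 * r) ^+ k <= M) ->
    forall n z, cabs z <= r -> cabs (F z - psum b n z) <= 4 * M / 2 ^+ n.
Proof.
move=> hb.
have term (r M : R) : 0 < r -> (forall k, cabs (b k) * (2 * r) ^+ k <= M) ->
    forall z, cabs z <= r -> forall k, cabs (b k * z ^+ k) <= M / 2 ^+ k.
  move=> r0 hM z zr k; rewrite ler_pdivlMr ?exprn_gt0// cabsM cabsX.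
  apply: le_trans (hM k); rewrite -mulrA ler_wpM2l ?cabs_ge0// exprMn mulrC.
  by rewrite ler_wpM2l ?exprn_ge0// lerXn2r ?nnegrE ?cabs_ge0// ltW.
have /choice[F hF] : forall z, exists l, forall (r M : R), 0 < r ->
    (forall k, cabs (b k) * (2 * r) ^+ k <= M) -> cabs z <= r ->
    forall n, cabs (l - psum b n z) <= 4 * M / 2 ^+ n.
  move=> z; have r0 : 0 < cabs z + 1 by rewrite ltr_wpDl ?cabs_ge0.
  have [M hM] : exists M : R, forall k, cabs (b k) * (2 * (cabs z + 1)) ^+ k <= M.
    by apply: hb; rewrite mulr_gt0.
  have zr : cabs z <= cabs z + 1 by rewrite lerDl.
  have [l hl] := geom_limit (term _ _ r0 hM z zr).
  (* The limit was built with the radius |z| + 1 but must obey the bound for every admissible pair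
     (r, N), since [F] is chosen before r. A distant partial sum mediates. *)
  exists l => r N rpos hN zr' n.
  apply/ler_addgt0Pr => e e0.
  have [n0 hn0] := small_pow2 (4 * M) e0.
  pose m := maxn n n0.
  rewrite -(subrK (psum b m z) l) -addrA (le_trans (cabsD _ _))// [leLHS]addrC lerD//; last first.
    by apply: (le_trans (hl m)); apply: hn0; rewrite leq_maxr.
  apply: (le_trans (geom_partial_sum (term _ _ rpos hN z zr') (leq_maxl n n0))).
  have N0 : 0 <= N.
    by have := hN 0%N; rewrite expr0 mulr1; apply: le_trans; exact: cabs_ge0.
  have p0 j : 0 <= N / 2 ^+ j by rewrite divr_ge0// exprn_ge0.
  rewrite -!mulrA; have := p0 n; have := p0 (maxn n n0); lra.
exists F; split; last by move=> r M r0 hM n z zr; apply: (hF z r M).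
move=> z; apply/cderivableP.
have r0 : 0 < cabs z + 1 by rewrite ltr_wpDl ?cabs_ge0.
(* The 4 is 2 * 2: one factor 2 gives geometric convergence on |w| <= |z| + 1, the other absorbs the
   factor k <= 2^k of the differentiated series. *)
have [M hM] : exists M : R, forall k, cabs (b k) * (4 * (cabs z + 1)) ^+ k <= M.
  by apply: hb; rewrite mulr_gt0.
have M0 : 0 <= M.
  by have := hM 0%N; rewrite expr0 mulr1; apply: le_trans; exact: cabs_ge0.
have hM2 k : cabs (b k) * (2 * (cabs z + 1)) ^+ k <= M.
  apply: le_trans (hM k); rewrite ler_wpM2l ?cabs_ge0// lerXn2r ?nnegrE ?mulr_ge0 ?ltW//.
  by rewrite ltr_pM2r// ltr_nat.
have bz k : cabs (b k) * (cabs z + 1) ^+ k <= M / 2 ^+ k.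
  by rewrite ler_pdivlMr ?exprn_gt0// -mulrA -exprMn (mulrC (cabs z + 1)).
have dterm k : cabs (b k * (k%:R * z ^+ k.-1)) <= M / 2 ^+ k.
  have E : cabs (k%:R * z ^+ k.-1) = k%:R * cabs z ^+ k.-1.
    by rewrite cabsM cabsX natC cabs_real ger0_norm.
  have k2 : k%:R <= 2 ^+ k :> R by rewrite -natrX ler_nat ltnW// ltn_expl.
  have zk : cabs z ^+ k.-1 <= (cabs z + 1) ^+ k.
    apply: (@le_trans _ _ ((cabs z + 1) ^+ k.-1)).
      by rewrite lerXn2r ?nnegrE ?cabs_ge0 ?(ltW r0)// lerDl.
    by rewrite ler_weXn2l ?leq_pred// lerDr cabs_ge0.
  rewrite ler_pdivlMr ?exprn_gt0//; apply: le_trans (hM k).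
  have -> : (4 * (cabs z + 1)) ^+ k = 2 ^+ k * (cabs z + 1) ^+ k * 2 ^+ k.
    by rewrite (_ : 4 = 2 * 2 :> R) ?exprMn -?natrM//; ring.
  rewrite cabsM E -[leLHS]mulrA ler_wpM2l ?cabs_ge0// ler_wpM2r ?exprn_ge0//.
  by rewrite ler_pM ?exprn_ge0 ?cabs_ge0.
have [A hA] := geom_limit dterm.
exists A => e e0.
have M1 : 0 < 2 * M + 1 by rewrite ltr_wpDl// mulr_ge0.
exists (Num.min 1 (e / (2 * M + 1))); first by rewrite lt_min ltr01 divr_gt0.
move=> h; rewrite lt_min => /andP[/ltW h1 h2].
apply: (@le_trans _ _ (2 * M * cabs h ^+ 2)); last first.
  rewrite expr2 mulrA ler_wpM2r ?cabs_ge0//.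
  move: h2; rewrite ltr_pdivlMr// => /ltW; apply: le_trans.
  by rewrite mulrC ler_wpM2l ?cabs_ge0// lerDl.
(* Three truncation errors, for F at z + h, for F at z and for the derivative series; the last is
   multiplied by |h| <= 1. *)
apply/ler_addgt0Pr => e' e'0.
have e'4 : 0 < e' / 3 by rewrite divr_gt0.
have [n hn] := small_pow2 (4 * M) e'4.
have {}hn := hn n (leqnn n).
have zh : cabs (z + h) <= cabs z + 1 by rewrite (le_trans (cabsD _ _))// lerD2l.
have zr : cabs z <= cabs z + 1 by rewrite lerDl.
have F1 := le_trans (hF (z + h) _ _ r0 hM2 zh n) hn.
have F2 := le_trans (hF z _ _ r0 hM2 zr n) hn.
have A1 := le_trans (hA n) hn.
have S1 : cabs (psum b n (z + h) - psum b n z - (\sum_(k < n) b k * (k%:R * z ^+ k.-1)) * h)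
    <= 2 * M * cabs h ^+ 2.
  have -> : psum b n (z + h) - psum b n z - (\sum_(k < n) b k * (k%:R * z ^+ k.-1)) * h
     = \sum_(k < n) b k * ((z + h) ^+ k - z ^+ k - k%:R * z ^+ k.-1 * h).
    rewrite mulr_suml -!sumrB; apply: eq_bigr => k _.
    by rewrite !mulrBr !mulrA.
  apply: (le_trans (cabs_sum _ _ _)).
  apply: (@le_trans _ _ (\sum_(k < n) cabs h ^+ 2 * (M / 2 ^+ k))).
    apply: ler_sum => k _; rewrite cabsM.
    apply: (@le_trans _ _ (cabs (b k) * (cabs h ^+ 2 * (cabs z + 1) ^+ k))).
      by rewrite ler_wpM2l ?cabs_ge0// exprD_taylor_bound.
    by rewrite mulrCA ler_wpM2l ?exprn_ge0 ?cabs_ge0.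
  rewrite -mulr_sumr mulrC ler_wpM2r ?exprn_ge0 ?cabs_ge0//.
  suff -> : \sum_(k < n) M / 2 ^+ k = 2 * M - 2 * M / 2 ^+ n.
    by rewrite gerDl oppr_le0 divr_ge0 ?mulr_ge0 ?exprn_ge0.
  elim: n {hn F1 F2 A1} => [|n IHn]; first by rewrite big_ord0 expr0 divr1 subrr.
  by rewrite big_ord_recr /= IHn exprS; field; rewrite expf_neq0.
set S := \sum_(k < n) _ in A1 S1.
have -> : F (z + h) - F z - A * h = (psum b n (z + h) - psum b n z - S * h) +
  ((F (z + h) - psum b n (z + h)) - (F z - psum b n z) - (A - S) * h) by ring.
rewrite (le_trans (cabsD _ _))// lerD//.
rewrite (le_trans (cabsB _ _))//.
have -> : e' = e' / 3 + e' / 3 + e' / 3 by field.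
rewrite lerD//; first by rewrite (le_trans (cabsB _ _))// lerD.
by rewrite cabsM -[leRHS]mulr1 ler_pM ?cabs_ge0.
Qed.

Lemma cabs_bounded_disc F r : (forall w, ccontinuous_at F w) ->
  exists M : R, forall z, cabs z <= r -> cabs (F z) <= M.
Proof.
move=> cF.
have cK : continuous (fun p : R * R => cabs (F (p.1 +i* p.2))).
  apply: ccontinuous_cabs; apply: (ccontinuous_comp (g := fun p : R * R => p.1 +i* p.2)) => //.
  by split=> p /=; [exact: cvg_fst|exact: cvg_snd].
have [M hM] := compact_rect_bounded (- r) r (- r) r cK.
exists M => z zr; have := hM (Re z) (Im z).
rewrite -!ler_norml (le_trans (ler_Re_cabs z) zr) (le_trans (ler_Im_cabs z) zr).
move=> /(_ isT isT) /=; rewrite ger0_norm ?cabs_ge0//.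
by case: (z).
Qed.

Lemma le_maxmod F z : entire F -> cabs (F z) <= maxmod F (cabs z).
Proof.
move=> eF; have [M hM] := cabs_bounded_disc (cabs z) (entire_continuous eF).
apply: ub_le_sup; last by exists z.
by exists M => _ [w /= wz <-]; apply: hM; rewrite wz.
Qed.

Lemma maxmod_le F r (M : R) : 0 <= r -> (forall z, cabs z = r -> cabs (F z) <= M) ->
  maxmod F r <= M.
Proof.
move=> r0 FM; apply: ge_sup.
  by exists (cabs (F r%:C)), r%:C => //=; rewrite cabs_real ger0_norm.
by move=> _ [w /= wr <-]; exact: FM.
Qed.

End PowerSeries.

(** * Order and Taylor coefficients *)

Section UpperLimits.
Variable R : realType.
Implicit Types (u : nat -> R) (c : R).

Lemma limf_esup_lt (T : choiceType) (X : filteredType T) (f : X -> \bar R)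
    (F : set_system X) (FF : Filter F) (c : \bar R) :
  (limf_esup f F < c)%E -> \forall x \near F, (f x < c)%E.
Proof.
move=> /ereal_inf_lt[_ [V FV <-]] h; apply: filterS FV => x Vx.
by apply: le_lt_trans h; apply: ereal_sup_ubound; exists x.
Qed.

Lemma limf_esup_le (T : choiceType) (X : filteredType T) (f : X -> \bar R)
    (F : set_system X) (c : \bar R) :
  (\forall x \near F, (f x <= c)%E) -> (limf_esup f F <= c)%E.
Proof.
move=> h; apply: ge_ereal_inf.
exists (ereal_sup (f @` [set x | (f x <= c)%E])); first by exists [set x | (f x <= c)%E].
by apply: ge_ereal_sup => _ [x /= hx <-].
Qed.

Lemma limn_esup_lt u c : (limn_esup (fun n => (u n)%:E) < c%:E)%E ->
  exists N, forall n, (N <= n)%N -> u n < c.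
Proof.
by move=> /limf_esup_lt[N _ hN]; exists N => n /hN; rewrite lte_fin.
Qed.

Lemma limn_esup_le u c : (exists N, forall n, (N <= n)%N -> u n <= c) ->
  (limn_esup (fun n => (u n)%:E) <= c%:E)%E.
Proof.
by move=> [N hN]; apply: limf_esup_le; exists N => // n /= /hN; rewrite lee_fin.
Qed.

Lemma limn_einf_gt u c : (c%:E < limn_einf (fun n => (u n)%:E))%E ->
  exists N, forall n, (N <= n)%N -> c < u n.
Proof.
rewrite /limn_einf lteNr => h.
have [|N hN] := @limn_esup_lt (fun n => - u n) (- c); first exact: h.
by exists N => n /hN; rewrite ltrN2.
Qed.

End UpperLimits.

Section Growth.
Variable R : realType.
Local Notation C := R[i].
Implicit Types (F : C -> C) (r s t x : R) (k n : nat).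

(* [M(r) <= exp(r^s)] for large [r]. *)
Definition growth_le F s := exists r0 : R, forall r, r0 <= r ->
  maxmod F r <= expR (expR (s * ln r)).

Lemma order_growth F s : (entire_order F < s%:E)%E -> growth_le F s.
Proof.
move=> /limf_esup_lt h; have {h}[a [_ ha]] := h.
exists (Num.max (a + 1) 3) => r; rewrite ge_max => /andP[ra r3].
have lnr0 : 0 < ln r by apply: ln_gt0; lra.
have {}ha : ln (ln (maxmod F r)) / ln r < s.
  by rewrite -lte_fin; apply: ha; lra.
(* For M(r) <= 1 the iterated logarithm carries no information, but the double exponential exceeds 1
   anyway. *)
case: (leP (maxmod F r) 1) => [M1|M1].
  by apply: (le_trans M1); rewrite -expR0 ler_expR expR_ge0.
have lM : 0 < ln (maxmod F r) by exact: ln_gt0.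
rewrite -[leLHS]lnK ?posrE ?(lt_trans ltr01)// ler_expR -[leLHS]lnK// ler_expR.
by rewrite -ler_pdivrMr// ltW.
Qed.

Lemma growth_order F s : 0 <= s -> growth_le F s -> (entire_order F <= s%:E)%E.
Proof.
move=> s0 [r0 h]; apply: limf_esup_le.
exists (Num.max r0 3); split; first exact: num_real.
move=> r; rewrite gt_max => /andP[/ltW rr r3] /=; rewrite lee_fin.
have lnr0 : 0 < ln r by apply: ln_gt0; lra.
have {h}hM := h r rr.
(* [ln] is 0 on nonpositive numbers, so the quotient is then 0, which is where [0 <= s] is used. *)
case: (leP (ln (maxmod F r)) 0) => [l0|l0].
  by rewrite (ln0 l0) mul0r.
rewrite ler_pdivrMr// -ler_expR lnK//.
case: (leP (maxmod F r) 1) => [M1|M1]; first by move: (ln_le0 M1); rewrite leNgt l0.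
by rewrite -ler_expR lnK// posrE (lt_trans ltr01).
Qed.

Lemma ln_unbounded (K t : R) : 0 < t ->
  exists N, forall n, (N <= n)%N -> (0 < n)%N /\ K <= t * ln n%:R.
Proof.
move=> t0; exists (Num.truncn (expR (K / t))).+1 => n Nn.
have n0 : (0 < n)%N by exact: leq_trans Nn.
split => //; rewrite mulrC -ler_pdivrMr// -ler_expR lnK ?posrE ?ltr0n//.
by apply: (le_trans (ltW (truncnS_gt _))); rewrite ler_nat.
Qed.

(* The weight [n^(-n/s)], equal to [1] at [n = 0]. *)
Definition wt s n : R := expR (- (n%:R * ln n%:R / s)).

Lemma wt_gt0 s n : 0 < wt s n.
Proof. exact: expR_gt0. Qed.

Lemma expR_mulrn x n : expR (n%:R * x) = expR x ^+ n.
Proof. by rewrite mulrC expRM_natr. Qed.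

(* The maximum over real [n] of [(x n^(-1/s))^n] is [exp(x^s/(e s))]; dropping
   the factor [e] it follows from [ln y <= y] with [y = x^s/n]. *)
Lemma wt_mul_le s n x : 0 < s -> 0 < x -> wt s n * x ^+ n <= expR (expR (s * ln x) / s).
Proof.
move=> s0 x0; case: n => [|n].
  rewrite /wt mul0r mul0r oppr0 expR0 mulr1 -[leLHS]expR0 ler_expR.
  by rewrite divr_ge0 ?expR_ge0// ltW.
rewrite -{1}(@lnK _ x)// -expR_mulrn /wt -expRD ler_expR.
set N := n.+1%:R : R; have N0 : 0 < N by rewrite ltr0n.
have := ltW (ln_sublinear (divr_gt0 (expR_gt0 (s * ln x)) N0)).
rewrite ln_div ?posrE ?expR_gt0// expRK => h.
have -> : - (N * ln N / s) + N * ln x = N / s * (s * ln x - ln N).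
  by field; rewrite gt_eqF.
have -> : expR (s * ln x) / s = N / s * (expR (s * ln x) / N).
  by field; rewrite !gt_eqF.
by rewrite ler_pM2l// divr_gt0.
Qed.

(** On |z| <= r the factor 2 in [2 * r] becomes a factor 2^-k in the k-th term, and these sum to at
    most 2. *)
Lemma coef_series_bound F r (M : R) z : entire F -> 0 <= M ->
  (forall k, cabs (coef F k) * (2 * r) ^+ k <= M) -> cabs z <= r -> cabs (F z) <= 2 * M.
Proof.
move=> eF M0 hM zr; have r0 : 0 <= r by apply: le_trans zr; exact: cabs_ge0.
have [K hK] := cabs_bounded_disc (2 * cabs z) (entire_continuous eF).
apply/ler_addgt0Pr => e e0.
have [n hn] := small_pow2 (4 * K) e0.
rewrite -(subrK (psum (coef F) n z) (F z)) addrC (le_trans (cabsD _ _))// lerD//; last first.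
  apply: le_trans (hn n (leqnn n)); apply: entire_tail_bound => // w ww.
  by apply: hK; rewrite ww.
have term k : cabs (coef F k * z ^+ k) <= M / 2 ^+ k.
  rewrite ler_pdivlMr ?exprn_gt0// cabsM cabsX; apply: le_trans (hM k).
  rewrite -mulrA ler_wpM2l ?cabs_ge0// exprMn mulrC.
  by rewrite ler_wpM2l ?exprn_ge0// lerXn2r ?nnegrE ?cabs_ge0.
have := geom_partial_sum term (leq0n n).
rewrite big_ord0 subr0 expr0 divr1 => /le_trans; apply.
by rewrite gerDl oppr_le0 divr_ge0 ?mulr_ge0 ?exprn_ge0.
Qed.

Lemma coef_growth F s s' (D : R) : entire F -> 0 < s -> s < s' ->
  (forall k, cabs (coef F k) <= D * wt s k) -> growth_le F s'.
Proof.
move=> eF s0 ss' hD; have D0 : 0 <= D.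
  have := hD 0%N; rewrite /wt !mul0r oppr0 expR0 mulr1; apply: le_trans.
  exact: cabs_ge0.
(* The second term is 2^s/s: the coefficient bound is used at radius 2r, and (2r)^s = 2^s r^s. *)
pose K := ln (2 * D + 1) + expR (s * ln 2) / s.
have d0 : 0 < s' - s by rewrite subr_gt0.
(* From here on (s' - s) ln r >= |K|, hence K <= r^(s' - s), because e^x >= x. *)
exists (Num.max 1 (expR (`|K| / (s' - s)))) => r; rewrite ge_max => /andP[r1 rK].
have r0 : 0 < r by rewrite (lt_le_trans ltr01).
have Kr : K <= expR ((s' - s) * ln r).
  apply: (le_trans (ler_norm K)).
  apply: (@le_trans _ _ ((s' - s) * ln r)); last first.
    by apply: le_trans (expR_ge1Dx _); rewrite lerDr.
  by rewrite mulrC -ler_pdivrMr// -ler_expR lnK.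
have lr0 : 0 <= ln r by exact: ln_ge0.
apply: (@le_trans _ _ (2 * (D * expR (expR (s * ln (2 * r)) / s)))).
  apply: maxmod_le; first exact: ltW.
  move=> z zr; apply: (@coef_series_bound F r) => //; last by rewrite zr.
    by rewrite mulr_ge0// expR_ge0.
  move=> k; apply: (@le_trans _ _ (D * wt s k * (2 * r) ^+ k)).
    by rewrite ler_wpM2r ?hD// exprn_ge0// mulr_ge0// ltW.
  by rewrite -mulrA ler_wpM2l// wt_mul_le// mulr_gt0.
apply: (@le_trans _ _ (expR (ln (2 * D + 1) + expR (s * ln (2 * r)) / s))).
  rewrite expRD mulrA ler_wpM2r ?expR_ge0// lnK ?lerDl//.
  by rewrite posrE ltr_wpDl// mulr_ge0.
rewrite ler_expR; apply: (@le_trans _ _ (K * expR (s * ln r))).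
  have L0 : 0 <= ln (2 * D + 1) by apply: ln_ge0; rewrite lerDr mulr_ge0.
  rewrite /K; set L := ln (2 * D + 1) in L0 *.
  rewrite lnM ?posrE// mulrDr expRD (mulrAC (expR (s * ln 2))) [leRHS]mulrDl lerD2r.
  by rewrite ler_peMr// -expR0 ler_expR mulr_ge0// ltW.
apply: (@le_trans _ _ (expR ((s' - s) * ln r) * expR (s * ln r))).
  by rewrite ler_wpM2r ?expR_ge0.
by rewrite -expRD -mulrDl subrK.
Qed.

Lemma growth_coef F s : entire F -> 0 < s -> growth_le F s ->
  exists N, forall k, (N <= k)%N -> cabs (coef F k) <= 2 * (expR 1 ^+ k * wt s k).
Proof.
move=> eF s0 [r0 hr0].
have s10 : 0 < s^-1 by rewrite invr_gt0.
have [N hN] := ln_unbounded (ln (Num.max r0 1)) s10.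
exists N => k /hN[k0 hk].
have kR : 0 < k%:R :> R by rewrite ltr0n.
(* Here r^s = k, so M(r) <= e^k, the origin of [expR 1 ^+ k], and r^k is the inverse of [wt s k]. *)
pose r := expR (s^-1 * ln k%:R) : R.
have rr0 : r0 <= r.
  apply: (@le_trans _ _ (Num.max r0 1)); first by rewrite le_max lexx.
  rewrite -[leLHS]lnK ?ler_expR// posrE lt_max ltr01; exact: orbT.
have rpos : 0 < r by exact: expR_gt0.
have FM w : cabs w = r -> cabs (F w) <= maxmod F r by move=> <-; exact: le_maxmod.
have h := coef_bound k eF rpos FM.
have hM := hr0 r rr0.
rewrite {2}/r expRK mulrA mulfV ?gt_eqF// mul1r lnK// in hM.
have rk : r ^+ k = (wt s k)^-1.
  by rewrite /r -expR_mulrn /wt expRN invrK; congr expR; ring.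
rewrite rk ler_pdivrMr ?wt_gt0// in h.
apply: (le_trans h); rewrite mulrA ler_wpM2r ?(ltW (wt_gt0 _ _))//.
by rewrite ler_pM2l// -expR_mulrn mulr1.
Qed.

End Growth.

(** * Best approximation in X *)

Section BanachSpace.
Variables (R : realType) (inX : set (R[i] -> R[i])) (nrm : (R[i] -> R[i]) -> R).
Hypothesis HX : fun_Banach_space inX nrm.
Local Notation C := R[i].
Local Notation tau := ((pi : R) *+ 2).
Local Notation zn := (normzn nrm).
Implicit Types (f g h F G : C -> C) (n k : nat) (z : C) (p : {poly C}).

Lemma inX_ext f g : eqD f g -> inX f -> inX g.
Proof. by case: HX => h _ _ _ _ fg /(h _ _ fg)[]. Qed.

Lemma nrm_ext f g : eqD f g -> inX f -> nrm g = nrm f.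
Proof. by case: HX => h _ _ _ _ fg /(h _ _ fg)[]. Qed.

Lemma inX_comb (a : C) f g : inX f -> inX g -> inX (fun z => a * f z + g z).
Proof. by case: HX => _ [_ h] _ _ _; exact: h. Qed.

Lemma inX0 : inX (fun=> 0).
Proof. by case: HX => _ [h _] _ _ _. Qed.

Lemma nrm_ge0 f : inX f -> 0 <= nrm f.
Proof. by case: HX => _ _ [h _] _ _ /h[]. Qed.

Lemma nrm_eq0 f : inX f -> nrm f = 0 -> eqD f (fun=> 0).
Proof. by case: HX => _ _ [h _] _ _ /h[_ []]. Qed.

Lemma nrmZ (a : C) f : inX f -> nrm (fun z => a * f z) = cabs a * nrm f.
Proof. by case: HX => _ _ [_ [h _]] _ _; exact: h. Qed.

Lemma nrmD f g : inX f -> inX g -> nrm (fun z => f z + g z) <= nrm f + nrm g.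
Proof. by case: HX => _ _ [_ [_ h]] _ _; exact: h. Qed.

Lemma inX_entire F : entire F -> inX F.
Proof. by case: HX => _ _ _ _ [_ h _]; exact: h. Qed.

Lemma inXB f g : inX f -> inX g -> inX (fun z => f z - g z).
Proof.
move=> fX gX; apply: (@inX_ext (fun z => (-1) * g z + f z)); last exact: inX_comb.
by move=> z _; rewrite mulN1r addrC.
Qed.

Lemma nrmBC f g : inX f -> inX g -> nrm (fun z => f z - g z) = nrm (fun z => g z - f z).
Proof.
move=> fX gX; have gfX := inXB gX fX.
rewrite -[RHS]mul1r -(cabs1 R) -cabsN -nrmZ//.
by congr nrm; apply/funext => z; rewrite mulN1r opprB.
Qed.

Lemma nrm_dist g f h : inX f -> inX g -> inX h ->
  nrm (fun z => f z - h z) <= nrm (fun z => f z - g z) + nrm (fun z => g z - h z).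
Proof.
move=> fX gX hX; apply: le_trans (nrmD (inXB fX gX) (inXB gX hX)).
by rewrite le_eqVlt; apply/orP; left; apply/eqP; congr nrm; apply/funext => z; rewrite addrA subrK.
Qed.

Lemma conv_bound f (g : R -> C) (c : R) : inX f -> ccontinuous g -> (forall t, cabs (g t) <= c) ->
  let F := fun z => (tau^-1)%:C * ci 0 tau (fun t => f (z * expi t) * g t) in
  inX F /\ nrm F <= c * nrm f.
Proof.
move=> fX cg gc F; have h : L1_02pi g.
  by split; [exact: (continuous_integrable_itv _ _ cg.1)|
             exact: (continuous_integrable_itv _ _ cg.2)].
case: HX => _ _ _ _ [_ _ conv]; have [FX Fn] := conv f g fX h.
split; first exact: FX.
apply: (le_trans Fn); rewrite ler_wpM2r ?nrm_ge0// ler_pdivrMl ?tau_gt0//.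
have cc : continuous (fun _ : R => c) by move=> t; exact: cvg_cst.
have := @ler_rint _ 0 tau _ _ (ccontinuous_cabs cg) cc (fun t _ => gc t).
by rewrite rint_cst ?tau_ge0// subr0 mulrC.
Qed.

Lemma inX_exprn n : inX (fun z => z ^+ n).
Proof. exact: inX_entire (@entire_exprn _ n). Qed.

Lemma normzn_gt0 n : 0 < zn n.
Proof.
rewrite lt_def nrm_ge0 ?andbT; last exact: inX_exprn.
apply/eqP => /(nrm_eq0 (inX_exprn n)) h.
have h2 : cabs (2^-1 : C) = 2^-1 by rewrite cabsV natC cabs_real ger0_norm.
have /h/eqP : diskD (2^-1 : C) by rewrite /diskD /= h2; lra.
by rewrite -cabs_eq0 cabsX h2 expf_eq0 invr_eq0 pnatr_eq0 andbF.
Qed.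

Lemma coef_norm G n : entire G -> cabs (coef G n) * zn n <= nrm G.
Proof.
move=> eG; have cg : ccontinuous (fun t => expi (- t) ^+ n : C).
  by apply: ccontinuousX; exact: ccontinuous_expiN.
have [|_] := @conv_bound G (fun t => expi (- t) ^+ n) 1 (inX_entire eG) cg.
  by move=> t; rewrite cabsX cabs_expi expr1n.
rewrite mul1r; apply: le_trans; rewrite -nrmZ; last exact: inX_exprn.
rewrite le_eqVlt; apply/orP; left; apply/eqP; congr nrm; apply/funext => z.
rewrite fourier_coef// fmorphV; set T := tau%:C; set w := coef G n * z ^+ n.
by rewrite mulrC mulfK// tauC_neq0.
Qed.

(** This crude rate only ensures that the Taylor series converges to F in [X]; [tail_norm_geom]
    gives the rate that matters. *)
Lemma tail_norm F n : entire F -> nrm (fun z => F z - psum (coef F) n z) <=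
  2 / 2 ^+ n * nrm (fun z => F (2 * z)).
Proof.
move=> eF; have eF2 := @entire_scale _ F 2 eF.
have [_] := conv_bound (inX_entire eF2) (@ccontinuous_cker R n) (@cabs_cker R n).
apply: le_trans; rewrite le_eqVlt; apply/orP; left; apply/eqP; congr nrm.
apply/funext => z; rewrite entire_tail// fmorphV; congr (_ * _).
by apply: ci_eq => t _; rewrite mulrA.
Qed.

Lemma inX_psum b n : inX (fun z => psum b n z).
Proof. by apply: inX_entire; exact: entire_psum. Qed.

Lemma psum_norm b n : nrm (fun z => psum b n z) <= \sum_(k < n) cabs (b k) * zn k.
Proof.
elim: n => [|n IHn].
  rewrite big_ord0; have -> : (fun z => psum b 0 z) = (fun z => 0 * (fun=> 0 : C) z).
    by apply/funext => z; rewrite /psum big_ord0 mul0r.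
  by rewrite nrmZ ?cabs0 ?mul0r//; exact: inX0.
rewrite big_ord_recr /=.
have -> : (fun z => psum b n.+1 z) = (fun z => psum b n z + b n * z ^+ n).
  by apply/funext => z; rewrite psumS.
have bX : inX (fun z => b n * z ^+ n).
  apply: (@inX_ext (fun z => b n * z ^+ n + 0)); first by move=> z _; rewrite addr0.
  exact: (inX_comb _ (inX_exprn n) inX0).
apply: (le_trans (nrmD (inX_psum b n) bX)).
by rewrite (nrmZ _ (inX_exprn n)) lerD2r.
Qed.

(** The triangle inequality compares the tails at n and at n + d; [tail_norm] disposes of the latter
    as d grows. Since q <= 1/2, the difference 2K q^n - 2K q^(n+d) dominates the terms split off. *)
Lemma tail_norm_geom F n (K q : R) : entire F -> 0 <= K -> 0 <= q <= 2^-1 ->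
  (forall k, (n <= k)%N -> cabs (coef F k) * zn k <= K * q ^+ k) ->
  nrm (fun z => F z - psum (coef F) n z) <= 2 * K * q ^+ n.
Proof.
move=> eF K0 /andP[q0 q2] hq; have FX := inX_entire eF.
have step d : nrm (fun z => F z - psum (coef F) n z) <=
    nrm (fun z => F z - psum (coef F) (n + d) z) + 2 * K * q ^+ n - 2 * K * q ^+ (n + d).
  elim: d => [|d IHd]; first by rewrite addn0 addrK.
  apply: (le_trans IHd); set m := (n + d)%N; rewrite addnS -/m.
  have cX : inX (fun z => coef F m * z ^+ m).
    apply: (@inX_ext (fun z => coef F m * z ^+ m + 0)); first by move=> z _; rewrite addr0.
    exact: (inX_comb _ (inX_exprn m) inX0).
  have := nrmD (inXB FX (inX_psum (coef F) m.+1)) cX.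
  rewrite (nrmZ _ (inX_exprn m)).
  have -> : (fun z => F z - psum (coef F) m.+1 z + coef F m * z ^+ m) =
            (fun z => F z - psum (coef F) m z).
    by apply/funext => z; rewrite psumS opprD addrA subrK.
  have := hq m (leq_addr _ _); rewrite exprS.
  have : q * (K * q ^+ m) <= 2^-1 * (K * q ^+ m).
    by rewrite ler_wpM2r// mulr_ge0// exprn_ge0.
  rewrite -/(zn m); lra.
apply/ler_addgt0Pr => e e0.
have [d hd] := small_pow2 (2 * nrm (fun z => F (2 * z))) e0.
apply: (le_trans (step d)); rewrite (addrC (nrm _)) -addrA lerD2l.
apply: (@le_trans _ _ (nrm (fun z => F z - psum (coef F) (n + d) z))).
  by rewrite gerDl oppr_le0 !mulr_ge0// exprn_ge0.
apply: (le_trans (tail_norm _ eF)); apply: le_trans (hd (n + d)%N _); last exact: leq_addl.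
by rewrite mulrAC.
Qed.

Lemma horner_psum p n z : (size p <= n)%N -> p.[z] = psum (fun k => p`_k) n z.
Proof. by move=> pn; rewrite (horner_coef_wide _ pn). Qed.

Lemma coef_horner p k : coef (fun z => p.[z]) k = p`_k.
Proof.
pose n := maxn (size p) k.+1.
have -> : (fun z => p.[z]) = psum (fun k => p`_k) n.
  by apply/funext => z; apply: horner_psum; exact: leq_maxl.
by rewrite coef_psum// leq_maxr.
Qed.

Lemma entireB F G : entire F -> entire G -> entire (fun z => F z - G z).
Proof.
move=> eF eG z; apply: cderivableD; first exact: eF.
have -> : (fun w => - G w) = (fun w => (-1) * G w) by apply/funext => w; rewrite mulN1r.
by apply: cderivableM; [exact: entire_cst|exact: eG].
Qed.

Lemma coef_subf F G k : entire F -> entire G ->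
  coef (fun z => F z - G z) k = coef F k - coef G k.
Proof.
move=> eF eG; apply: (mulIf (tauC_neq0 R)); rewrite mulrBl !coef_tau -ciB.
- by apply: ci_eq => t _; rewrite mulrBl.
- exact: ccontinuous_fourier1 (entire_continuous eF).
- exact: ccontinuous_fourier1 (entire_continuous eG).
Qed.

Section BestApproximation.
Variable f : C -> C.
Hypothesis fX : inX f.
Local Notation E := (En nrm f).

Lemma inX_horner p : inX (fun z => p.[z]).
Proof. by apply: inX_entire; exact: entire_horner. Qed.

Let S n := [set nrm (fun z => f z - p.[z]) | p in [set p : {poly C} | (size p <= n)%N]].

Let lbS n : lbound (S n) 0.
Proof. by move=> _ [p _ <-]; apply: nrm_ge0; apply: inXB => //; exact: inX_horner. Qed.

Lemma En_le n p : (size p <= n)%N -> E n <= nrm (fun z => f z - p.[z]).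
Proof. by move=> pn; apply: ge_inf; [exists 0; exact: lbS|exists p]. Qed.

Lemma En_ge n (c : R) :
  (forall p, (size p <= n)%N -> c <= nrm (fun z => f z - p.[z])) -> c <= E n.
Proof.
move=> h; apply: lb_le_inf; last by move=> _ [p pn <-]; exact: h.
by exists (nrm (fun z => f z - (0 : {poly C}).[z])), 0 => //=; rewrite size_poly0.
Qed.

Lemma En_ge0 n : 0 <= E n.
Proof.
by apply: En_ge => p _; apply: nrm_ge0; apply: inXB => //; exact: inX_horner.
Qed.

Lemma En_mono n : E n.+1 <= E n.
Proof. by apply: En_ge => p pn; apply: En_le; exact: leqW. Qed.

(** Subtracting a polynomial of degree below n leaves the n-th coefficient unchanged, so [coef_norm]
    applies to every F - p. *)
Lemma coef_En F n : entire F -> eqD f F -> cabs (coef F n) * zn n <= E n.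
Proof.
move=> eF fF; apply: En_ge => p pn; have ep := @entire_horner _ p.
have -> : nrm (fun z => f z - p.[z]) = nrm (fun z => F z - p.[z]).
  apply: nrm_ext; last exact: inX_entire (entireB eF ep).
  by move=> z /fF ->.
apply: le_trans (coef_norm n (entireB eF ep)).
by rewrite coef_subf// coef_horner nth_default ?subr0.
Qed.

Lemma En_upper F n : entire F -> eqD f F ->
  E n <= nrm (fun z => F z - psum (coef F) n z).
Proof.
move=> eF fF; apply: (le_trans (En_le (size_poly n (coef F)))).
rewrite le_eqVlt; apply/orP; left; apply/eqP.
have -> : (fun z => f z - (\poly_(k < n) coef F k).[z]) = (fun z => f z - psum (coef F) n z).
  by apply/funext => z; rewrite horner_poly.
apply: nrm_ext; first by move=> z /fF ->.
exact: inXB (inX_entire eF) (inX_psum _ _).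
Qed.

End BestApproximation.

End BanachSpace.

(** * Order and best approximation *)

Lemma root_limit_lower (R : realType) (u : nat -> R) (m : R) : (forall n, 0 < u n) ->
  0 < m -> (m%:E < limn_einf (fun n => (u n `^ (n%:R^-1))%:E))%E ->
  exists N, forall n, (N <= n)%N -> m ^+ n <= u n.
Proof.
(* [N.+1] excludes n = 0, where [n%:R^-1] is 0 by convention and the root says nothing about
   [u 0]. *)
move=> u0 m0 /limn_einf_gt[N hN]; exists N.+1 => n Nn.
have n0 : n%:R != 0 :> R by rewrite pnatr_eq0 -lt0n (leq_trans _ Nn).
rewrite -[leRHS](powRr1 (ltW (u0 n))) -(mulVf n0) powRrM powR_mulrn ?powR_ge0//.
by rewrite lerXn2r ?nnegrE ?powR_ge0 ?(ltW m0)// ltW// hN// ltnW.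
Qed.

Lemma root_limit_upper (R : realType) (u : nat -> R) : (forall n, 0 < u n) ->
  (limn_esup (fun n => (u n `^ (n%:R^-1))%:E) < +oo)%E ->
  exists2 m : R, 0 < m & exists N, forall n, (N <= n)%N -> u n <= m ^+ n.
Proof.
move=> u0 h.
have [m hm] : exists m : R, (limn_esup (fun n => (u n `^ (n%:R^-1))%:E) < m%:E)%E.
  move: h; case: (limn_esup _) => [x|//|] _.
    by exists (x + 1); rewrite lte_fin ltrDl.
  by exists 0; rewrite ltNyr.
have {hm}[N hN] := limn_esup_lt hm; exists (Num.max m 1); first by rewrite lt_max ltr01 orbT.
exists N.+1 => n Nn.
have n0 : n%:R != 0 :> R by rewrite pnatr_eq0 -lt0n (leq_trans _ Nn).
have mx0 : 0 <= Num.max m 1 by rewrite le_max ler01 orbT.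
have um : u n `^ (n%:R^-1) <= Num.max m 1.
  by rewrite le_max (ltW (hN _ _))// ltnW.
rewrite [leLHS](_ : _ = (u n `^ (n%:R^-1)) ^+ n).
  exact: (lerXn2r n (powR_ge0 _ _) mx0 um).
by rewrite -powR_mulrn ?powR_ge0// -powRrM mulVf// powRr1// ltW.
Qed.

Section Asymptotics.
Variable R : realType.
Implicit Types (s m q : R) (n k : nat).

(** For k >= n the base e m k^(-1/s) is at most e m n^(-1/s); freezing it at n turns the tail into a
    geometric series. *)
Lemma wt_geom s m n k : 0 < s -> 0 < m -> (0 < n)%N -> (n <= k)%N ->
  expR 1 ^+ k * wt s k * m ^+ k <= expR (1 + ln m - ln n%:R / s) ^+ k.
Proof.
move=> s0 m0 n0 nk; have k0 : (0 < k)%N by exact: leq_trans nk.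
rewrite -[m in leLHS]lnK ?posrE// -!expR_mulrn /wt -!expRD ler_expR.
have -> : k%:R * (1 + ln m - ln n%:R / s) =
   k%:R * 1 - k%:R * ln n%:R / s + k%:R * ln m by ring.
rewrite lerD2r lerD2l lerN2 ler_wpM2r ?invr_ge0 ?(ltW s0)//.
by rewrite ler_wpM2l// ler_ln ?posrE ?ltr0n// ler_nat.
Qed.

Lemma wt_le_exp s m q : 0 < s -> 0 < m -> 0 < q ->
  exists N, forall n, (N <= n)%N -> m ^+ n * wt s n <= q ^+ n.
Proof.
move=> s0 m0 q0; have s10 : 0 < s^-1 by rewrite invr_gt0.
have [N hN] := ln_unbounded (ln m - ln q) s10; exists N => n /hN[n0 h].
rewrite -[m in leLHS]lnK ?posrE// -[q in leRHS]lnK ?posrE// -!expR_mulrn /wt -expRD ler_expR.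
have -> : n%:R * ln m - n%:R * ln n%:R / s = n%:R * (ln m - s^-1 * ln n%:R) by ring.
by rewrite ler_wpM2l// lerBlDr addrC -lerBlDr.
Qed.

End Asymptotics.

Section Correspondence.
Variables (R : realType) (inX : set (R[i] -> R[i])) (nrm : (R[i] -> R[i]) -> R).
Hypothesis HX : fun_Banach_space inX nrm.
Hypothesis Hmu1 : (0 < limn_einf (fun n : nat => (normzn nrm n `^ (n%:R^-1))%:E))%E.
Hypothesis Hmu2 : (limn_esup (fun n : nat => (normzn nrm n `^ (n%:R^-1))%:E) < +oo)%E.
Local Notation C := R[i].
Local Notation zn := (normzn nrm).

Lemma normzn_lower : exists2 m : R, 0 < m & exists N, forall n, (N <= n)%N -> m ^+ n <= zn n.
Proof.
have [m m0 hm] : exists2 m : R, 0 < m & (m%:E < limn_einf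
    (fun n : nat => (zn n `^ (n%:R^-1))%:E))%E.
  move: Hmu1; case: (limn_einf _) => [x| |//].
    rewrite lte_fin => x0; exists (x / 2); first by rewrite divr_gt0.
    by rewrite lte_fin; lra.
  by move=> _; exists 1 => //; rewrite ltry.
by exists m => //; apply: root_limit_lower => // n; exact: (normzn_gt0 HX).
Qed.

Lemma normzn_upper : exists2 m : R, 0 < m & exists N, forall n, (N <= n)%N -> zn n <= m ^+ n.
Proof. by apply: root_limit_upper => // n; exact: (normzn_gt0 HX). Qed.

Variable f : C -> C.
Hypothesis fX : inX f.
Local Notation E := (En nrm f).
Implicit Types (F : C -> C) (n k : nat) (s : R).

Definition En_wt s := exists N, forall n, (N <= n)%N -> E n <= zn n * wt s n.

Lemma growth_En F s s' : entire F -> eqD f F -> 0 < s -> s < s' ->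
  growth_le F s -> En_wt s'.
Proof.
move=> eF fF s0 ss' gF; have s'0 : 0 < s' by rewrite (lt_trans s0).
have [N1 h1] := growth_coef eF s0 gF.
have [m2 m20 [N2 h2]] := normzn_upper.
have [m1 m10 [N3 h3]] := normzn_lower.
have s10 : 0 < s^-1 by rewrite invr_gt0.
have ds : 0 < s^-1 - s'^-1 by rewrite subr_gt0 ltf_pV2.
(* [N4] makes the ratio q = e m2 n^(-1/s) at most 1/2. [N5] lets n^(n(1/s - 1/s')) absorb 4 (e
   m2/m1)^n, where 4 is the 2 of [growth_coef] times the 2 of [tail_norm_geom]. *)
have [N4 h4] := ln_unbounded (1 + ln m2 + ln 2) s10.
have [N5 h5] := ln_unbounded (ln 4 + 1 + ln m2 - ln m1) ds.
exists (maxn (maxn N1 N2) (maxn N3 (maxn N4 N5))) => n.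
rewrite !geq_max => /andP[/andP[n1 n2] /and3P[n3 /h4[n0 {}h4] /h5[_ {}h5]]].
set q := expR (1 + ln m2 - ln n%:R / s).
have qhalf : 0 <= q <= 2^-1.
  rewrite expR_ge0/= -[leRHS]lnK ?posrE ?invr_gt0// ler_expR lnV ?posrE//.
  by move: h4; rewrite mulrC; lra.
have hq k : (n <= k)%N -> cabs (coef F k) * zn k <= 2 * q ^+ k.
  move=> nk; have k1 := leq_trans n1 nk; have k2 := leq_trans n2 nk.
  apply: (@le_trans _ _ (2 * (expR 1 ^+ k * wt s k) * m2 ^+ k)).
    by rewrite ler_pM ?cabs_ge0 ?h1 ?h2// ltW// (normzn_gt0 HX).
  by rewrite -mulrA ler_pM2l// wt_geom.
apply: (le_trans (En_upper HX fX n eF fF)).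
apply: (le_trans (tail_norm_geom HX eF (ler0n R 2) qhalf hq)).
apply: (@le_trans _ _ (m1 ^+ n * wt s' n)); last first.
  by rewrite ler_pM2r ?wt_gt0// h3.
have e4 : 2 * 2 = expR (ln 4) :> R by rewrite lnK ?posrE// -natrM.
have em1 : m1 ^+ n = expR (n%:R * ln m1) by rewrite expR_mulrn lnK.
rewrite e4 em1 /q -expR_mulrn /wt -!expRD ler_expR.
have n1R : 1 <= n%:R :> R by rewrite ler1n.
have ln4 : 0 <= ln 4 :> R by apply: ln_ge0; rewrite ler1n.
apply: (@le_trans _ _ (n%:R * (ln 4 + (1 + ln m2 - ln n%:R / s)))).
  by rewrite [leRHS]mulrDr lerD2r ler_peMl.
rewrite -mulrA -mulrBr ler_pM2l ?ltr0n//.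
move: h5; rewrite mulrBl (mulrC s^-1) (mulrC s'^-1); lra.
Qed.

Lemma En_coef_growth F s s' : entire F -> eqD f F -> 0 < s -> s < s' ->
  En_wt s -> growth_le F s'.
Proof.
move=> eF fF s0 ss' [N hN].
(* The 1 serves k >= N, where [coef_En] and the bound on [E k] share the factor [zn k]; the sum
   serves the finitely many k < N. *)
pose D := 1 + \sum_(k < N) cabs (coef F k) / wt s k.
have S0 : 0 <= \sum_(k < N) cabs (coef F k) / wt s k.
  by apply: sumr_ge0 => k _; rewrite divr_ge0 ?cabs_ge0// ltW ?wt_gt0.
apply: (@coef_growth _ F s s' D) => // k; rewrite -ler_pdivrMr ?wt_gt0//.
case: (leqP N k) => kN.
  apply: (@le_trans _ _ 1); last by rewrite lerDl.
  rewrite ler_pdivrMr ?wt_gt0// mul1r -(ler_pM2l (normzn_gt0 HX k)).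
  by apply: le_trans (hN k kN); rewrite mulrC; exact: (coef_En HX k eF fF).
rewrite /D (bigD1 (Ordinal kN)) //= addrCA lerDl addr_ge0//.
by apply: sumr_ge0 => j _; rewrite divr_ge0 ?cabs_ge0// ltW ?wt_gt0.
Qed.

(** If [E n = 0], the conventions x/0 = 0 and ln 0 = 0 make this 0, in agreement with an infinite
    logarithm in the denominator. *)
Definition rate n : R := (n%:R * ln n%:R) / ln (zn n / E n).

Lemma nlnn_gt0 n : (2 <= n)%N -> 0 < n%:R * ln n%:R :> R.
Proof. by move=> n2; rewrite mulr_gt0 ?ltr0n ?ln_gt0 ?ltr1n// (leq_trans _ n2). Qed.

Lemma wt_rate s n : 0 < s -> (2 <= n)%N -> E n <= zn n * wt s n -> rate n <= s.
Proof.
move=> s0 n2 h; have nl := nlnn_gt0 n2.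
have [E0|E0] := eqVneq (E n) 0.
  by rewrite /rate E0 invr0 mulr0 (ln0 (lexx 0)) invr0 mulr0 ltW.
have {}E0 : 0 < E n by rewrite lt_def E0 (En_ge0 HX fX).
have hl : n%:R * ln n%:R / s <= ln (zn n / E n).
  rewrite -ler_expR lnK ?posrE ?divr_gt0// ?(normzn_gt0 HX)//.
  rewrite ler_pdivlMr// mulrC -ler_pdivlMr ?expR_gt0// -expRN.
  exact: h.
have l0 : 0 < ln (zn n / E n) by rewrite (lt_le_trans _ hl)// divr_gt0.
by rewrite /rate ler_pdivrMr// (mulrC s) -ler_pdivrMr.
Qed.

Lemma rate_wt s n : 0 < s -> (2 <= n)%N -> E n < zn n -> rate n <= s ->
  E n <= zn n * wt s n.
Proof.
move=> s0 n2 Ez; have nl := nlnn_gt0 n2; have z0 := normzn_gt0 HX n.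
have [->|E0] := eqVneq (E n) 0; first by move=> _; rewrite mulr_ge0 ?ltW ?wt_gt0.
have {}E0 : 0 < E n by rewrite lt_def E0 (En_ge0 HX fX).
have l0 : 0 < ln (zn n / E n) by rewrite ln_gt0// ltr_pdivlMr// mul1r.
rewrite /rate ler_pdivrMr// (mulrC s) -ler_pdivrMr// => h.
have {}h : expR (n%:R * ln n%:R / s) <= zn n / E n.
  by rewrite -[leRHS]lnK ?posrE ?divr_gt0// ler_expR.
by rewrite /wt expRN ler_pdivlMr ?expR_gt0// mulrC -ler_pdivlMr.
Qed.

Lemma wt_lt1 s n : 0 < s -> (2 <= n)%N -> wt s n < 1.
Proof.
by move=> s0 n2; rewrite -expR0 ltr_expR oppr_lt0 divr_gt0// nlnn_gt0.
Qed.

Lemma En_wt_rate s : 0 < s -> En_wt s -> exists N, forall n, (N <= n)%N -> rate n <= s.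
Proof.
move=> s0 [N hN]; exists (maxn N 2) => n; rewrite geq_max => /andP[Nn n2].
exact: wt_rate (hN n Nn).
Qed.

Lemma rate_En_wt s : 0 < s -> (exists N, forall n, (N <= n)%N -> E n < zn n) ->
  (exists N, forall n, (N <= n)%N -> rate n <= s) -> En_wt s.
Proof.
move=> s0 [N1 h1] [N2 h2]; exists (maxn (maxn N1 N2) 2) => n.
rewrite !geq_max => /andP[/andP[n1 n2] n3].
by apply: rate_wt => //; [exact: h1|exact: h2].
Qed.

Lemma En_wt_lt s : 0 < s -> En_wt s -> exists N, forall n, (N <= n)%N -> E n < zn n.
Proof.
move=> s0 [N hN]; exists (maxn N 2) => n; rewrite geq_max => /andP[Nn n2].
apply: (le_lt_trans (hN n Nn)); rewrite -[ltRHS]mulr1 ltr_pM2l ?(normzn_gt0 HX)//.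
exact: wt_lt1.
Qed.

Lemma le_ereal_above (rho : R) (L : \bar R) :
  (forall s, rho < s -> (L <= s%:E)%E) -> (L <= rho%:E)%E.
Proof.
move=> h; apply/lee_addgt0Pr => e e0; rewrite -EFinD; apply: h.
by rewrite ltrDl.
Qed.

Lemma ge_ereal_below (rho : R) (L : \bar R) : 0 < rho ->
  (forall s, 0 < s -> s < rho -> (s%:E <= L)%E) -> (rho%:E <= L)%E.
Proof.
move=> rho0 h; rewrite leNgt; apply/negP; case: L h => [l| |] h.
- rewrite lte_fin => lr.
  (* The maximum with 0 keeps the midpoint positive when [l] is negative. *)
  have := h ((Num.max l 0 + rho) / 2).
  have m0 : 0 <= Num.max l 0 by rewrite le_max lexx orbT.
  have ml : l <= Num.max l 0 by rewrite le_max lexx.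
  have mr : Num.max l 0 < rho by rewrite gt_max lr.
  have h1 : 0 < (Num.max l 0 + rho) / 2 by lra.
  have h2 : (Num.max l 0 + rho) / 2 < rho by lra.
  by move=> /(_ h1 h2); rewrite lee_fin; lra.
- by rewrite ltNge leey.
- have h1 : 0 < rho / 2 by rewrite divr_gt0.
  have h2 : rho / 2 < rho by lra.
  by have := h _ h1 h2.
Qed.

Local Notation L := (limn_esup (fun n => (rate n)%:E)).

Lemma growth_rate F s s' : entire F -> eqD f F -> 0 < s -> s < s' ->
  growth_le F s -> (L <= s'%:E)%E.
Proof.
move=> eF fF s0 ss' gF; apply: limn_esup_le; apply: En_wt_rate.
  exact: lt_trans ss'.
exact: growth_En gF.
Qed.

Lemma rate_growth F s s' : entire F -> eqD f F -> 0 < s -> s < s' ->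
  (exists N, forall n, (N <= n)%N -> E n < zn n) -> (L < s%:E)%E -> growth_le F s'.
Proof.
move=> eF fF s0 ss' hE /limn_esup_lt[N hN]; apply: (En_coef_growth eF fF s0 ss').
by apply: rate_En_wt => //; exists N => n /hN/ltW.
Qed.

(** Each implication between growth and approximation enlarges the exponent slightly, which a
    midpoint absorbs. For the lower bound, an upper limit below s < rho would force the order below
    rho. *)
Lemma entire_order_rate F (rho : R) : 0 < rho -> entire F -> eqD f F ->
  entire_order F = rho%:E -> L = rho%:E.
Proof.
move=> rho0 eF fF oF.
have gF s : rho < s -> growth_le F s by move=> h; apply: order_growth; rewrite oF lte_fin.
have hE : exists N, forall n, (N <= n)%N -> E n < zn n.
  apply: (@En_wt_lt (rho + 2)); first by rewrite addr_gt0.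
  apply: (@growth_En F (rho + 1)) => //; [lra|lra|apply: gF; lra].
apply/eqP; rewrite eq_le; apply/andP; split.
  apply: le_ereal_above => s rs; apply: (@growth_rate F ((rho + s) / 2)) => //; [lra|lra|].
  apply: gF; lra.
apply: ge_ereal_below => // s s0 sr; rewrite leNgt; apply/negP => Ls.
have h1 : s < (s + rho) / 2 by lra.
have h2 : (s + rho) / 2 < rho by lra.
have := growth_order (ltW (lt_trans s0 h1)) (rate_growth eF fF s0 h1 hE Ls).
by rewrite oF lee_fin leNgt h2.
Qed.

Lemma rate_entire_order F (rho : R) : 0 < rho -> entire F -> eqD f F ->
  (exists N, forall n, (N <= n)%N -> E n < zn n) ->
  L = rho%:E -> entire_order F = rho%:E.
Proof.
move=> rho0 eF fF hE LE; apply/eqP; rewrite eq_le; apply/andP; split.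
  apply: le_ereal_above => s rs; apply: growth_order; first lra.
  apply: (@rate_growth F ((rho + s) / 2)) => //; [lra|lra|rewrite LE lte_fin; lra].
apply: ge_ereal_below => // s s0 sr; rewrite leNgt; apply/negP => /order_growth gF.
have h1 : s < (s + rho) / 2 by lra.
have h2 : (s + rho) / 2 < rho by lra.
by have := growth_rate eF fF s0 h1 gF; rewrite LE lee_fin leNgt h2.
Qed.

End Correspondence.

(** * Convergence of the best approximations *)

Lemma eventually_bounded (R : realType) (u : nat -> R) (K : R) N :
  (forall k, (N <= k)%N -> u k <= K) -> exists M, forall k, u k <= M.
Proof.
move=> h; exists (`|K| + \sum_(k < N) `|u k|) => k.
have S0 : 0 <= \sum_(k < N) `|u k| by apply: sumr_ge0.
case: (leqP N k) => kN.
  by apply: (le_trans (h k kN)); rewrite (le_trans (ler_norm K))// lerDl.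
rewrite (bigD1 (Ordinal kN)) //= addrCA (le_trans (ler_norm _))// lerDl addr_ge0//.
by apply: sumr_ge0.
Qed.

Section Converse.
Variables (R : realType) (inX : set (R[i] -> R[i])) (nrm : (R[i] -> R[i]) -> R).
Hypothesis HX : fun_Banach_space inX nrm.
Hypothesis Hmu1 : (0 < limn_einf (fun n : nat => (normzn nrm n `^ (n%:R^-1))%:E))%E.
Hypothesis Hmu2 : (limn_esup (fun n : nat => (normzn nrm n `^ (n%:R^-1))%:E) < +oo)%E.
Variables (f : R[i] -> R[i]) (rho : R).
Hypotheses (fX : inX f) (rho0 : 0 < rho).
Local Notation C := R[i].
Local Notation zn := (normzn nrm).
Local Notation E := (En nrm f).
Hypothesis rateE : limn_esup (fun n => (rate nrm f n)%:E) = rho%:E.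
Implicit Types (n k m d : nat) (q : R).

Lemma rate_eventually_le s : rho < s ->
  exists N, forall n, (N <= n)%N -> rate nrm f n <= s.
Proof.
move=> rs; have [|N hN] := @limn_esup_lt _ (rate nrm f) s; first by rewrite rateE lte_fin.
by exists N => n /hN/ltW.
Qed.

(* An index with [E n >= zn n] contributes a nonpositive quotient, which the upper
   limit does not see, so [E n < zn n] is first obtained for infinitely many [n]
   only; it propagates to the next index because [E] is nonincreasing. *)
Lemma En_eventually_lt : exists N, forall n, (N <= n)%N -> E n < zn n.
Proof.
pose s := rho + 1; have s0 : 0 < s by rewrite addr_gt0.
have [N1 h1] : exists N, forall n, (N <= n)%N -> rate nrm f n <= s.
  by apply: rate_eventually_le; rewrite ltrDl.
have [m2 m20 [N2 h2]] := normzn_upper HX Hmu2.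
have [m1 m10 [N3 h3]] := normzn_lower HX Hmu1.
(* This gives c^n <= c < m1 for n >= 1, so that a bound (m1 c)^n on [E n] lies below m1^(n+1), hence
   below [zn n.+1]. *)
pose c := Num.min 1 m1 / 2.
have c0 : 0 < c by rewrite divr_gt0// lt_min ltr01.
have cm : c < m1.
  have : Num.min 1 m1 <= m1 by rewrite ge_min lexx orbT.
  by rewrite /c; lra.
have c1 : c <= 1.
  have : Num.min 1 m1 <= 1 by rewrite ge_min lexx.
  by rewrite /c; lra.
have [N4 h4] := wt_le_exp s0 m20 (mulr_gt0 m10 c0).
pose N := maxn (maxn (maxn N1 N2) (maxn N3 N4)) 2.
have step n : (N <= n)%N -> E n < zn n -> E n.+1 < zn n.+1.
  rewrite !geq_max => /andP[/andP[/andP[n1 n2] /andP[n3 n4]] n5] Ez.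
  apply: (le_lt_trans (En_mono HX fX n)).
  apply: (le_lt_trans (rate_wt HX fX s0 n5 Ez (h1 n n1))).
  apply: (@le_lt_trans _ _ (m2 ^+ n * wt s n)).
    by rewrite ler_wpM2r ?h2// ltW// wt_gt0.
  apply: (le_lt_trans (h4 n n4)); apply: lt_le_trans (h3 n.+1 (leqW n3)).
  rewrite exprMn exprS mulrC ltr_pM2r ?exprn_gt0//; apply: le_lt_trans cm.
  by rewrite -[leRHS]expr1; apply: ler_wiXn2l => //; [exact: ltW|exact: ltnW].
have [n0 [Nn0 n0P]] : exists n, (N <= n)%N /\ rho / 2 < rate nrm f n.
  apply: contrapT => hn; have : (rho%:E <= (rho / 2)%:E)%E.
    rewrite -rateE; apply: limn_esup_le; exists N => n Nn; rewrite leNgt.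
    by apply/negP => hh; apply: hn; exists n.
  by rewrite lee_fin; have := rho0; lra.
have n02 : (2 <= n0)%N by apply: leq_trans Nn0; rewrite leq_maxr.
have base : E n0 < zn n0.
  have r0 : 0 < rate nrm f n0 by apply: lt_trans n0P; rewrite divr_gt0.
  move: r0; rewrite /rate pmulr_rgt0 ?nlnn_gt0// invr_gt0 => l0.
  rewrite ltNge; apply/negP => zE; move: l0; rewrite ltNge => /negP; apply.
  have E0 : 0 < E n0 by apply: lt_le_trans zE; exact: (normzn_gt0 HX).
  by apply: ln_le0; rewrite ler_pdivrMr// mul1r.
exists n0 => n /subnKC <-; elim: (n - n0)%N => [|d IHd]; first by rewrite addn0.
by rewrite addnS; apply: step => //; rewrite (leq_trans Nn0)// leq_addr.
Qed.

Lemma En_wt_above s : rho < s -> En_wt nrm f s.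
Proof.
move=> rs; apply: (rate_En_wt HX fX); [exact: lt_trans rs|exact: En_eventually_lt|].
exact: rate_eventually_le.
Qed.

Lemma En_small q : 0 < q -> exists N, forall n, (N <= n)%N -> E n <= q ^+ n.
Proof.
move=> q0; have s0 : 0 < rho + 1 by rewrite addr_gt0.
have [|N1 h1] := @En_wt_above (rho + 1); first by rewrite ltrDl.
have [m2 m20 [N2 h2]] := normzn_upper HX Hmu2.
have [N3 h3] := wt_le_exp s0 m20 q0.
exists (maxn N1 (maxn N2 N3)) => n; rewrite !geq_max => /and3P[n1 n2 n3].
apply: (le_trans (h1 n n1)); apply: le_trans (h3 n n3).
by rewrite ler_wpM2r ?h2// ltW// wt_gt0.
Qed.

Variable pstar : nat -> {poly C}.
Hypothesis pstarP : forall n, (1 <= n)%N ->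
  (size (pstar n) <= n)%N /\ nrm (fun z => f z - (pstar n).[z]) = E n.

(** Consecutive best approximations differ in norm by at most E_(n+1) + E_n <= 2 E_n, and
    [coef_norm] transfers this to all coefficients at once. *)
Lemma pstar_coef_step n k : (1 <= n)%N ->
  cabs ((pstar n.+1)`_k - (pstar n)`_k) * zn k <= 2 * E n.
Proof.
move=> n1; have [_ e1] := pstarP n1; have [_ e2] := pstarP (leqW n1).
have := coef_norm HX k (@entire_horner _ (pstar n.+1 - pstar n)).
rewrite coef_horner coefB => /le_trans; apply.
have -> : (fun z => (pstar n.+1 - pstar n).[z]) =
    (fun z => (pstar n.+1).[z] - (pstar n).[z]).
  by apply/funext => z; rewrite hornerD hornerN.
apply: (le_trans (nrm_dist HX (inX_horner HX _) fX (inX_horner HX _))).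
rewrite (nrmBC HX (inX_horner HX _) fX) e1 e2 mulr_natl mulr2n lerD2r.
exact: (En_mono HX fX).
Qed.

(** The steps 2 q^j with j >= n sum to at most 4 q^n because q <= 1/2. The threshold [N] is uniform
    in [k]. *)
Lemma pstar_coef_cauchy q : 0 < q -> q <= 2^-1 -> exists N, forall n m k,
  (N <= n)%N -> (n <= m)%N -> cabs ((pstar m)`_k - (pstar n)`_k) * zn k <= 4 * q ^+ n.
Proof.
move=> q0 q2; have [N hN] := En_small q0; exists (maxn N 1) => n m k.
rewrite geq_max => /andP[Nn n1] /subnKC <-.
suff h d : cabs ((pstar (n + d))`_k - (pstar n)`_k) * zn k <=
    4 * q ^+ n - 4 * q ^+ (n + d).
  by apply: (le_trans (h _)); rewrite gerDl oppr_le0 mulr_ge0// exprn_ge0// ltW.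
elim: d => [|d IHd]; first by rewrite addn0 !subrr cabs0 mul0r.
set j := (n + d)%N; rewrite addnS -/j.
have jn1 : (1 <= j)%N by rewrite (leq_trans n1)// leq_addr.
have jN : (N <= j)%N by rewrite (leq_trans Nn)// leq_addr.
have s1 := pstar_coef_step k jn1; have s2 := hN j jN.
have s3 : q * q ^+ j <= 2^-1 * q ^+ j by rewrite ler_wpM2r// exprn_ge0// ltW.
have s4 : cabs ((pstar j.+1)`_k - (pstar n)`_k) * zn k <=
   cabs ((pstar j.+1)`_k - (pstar j)`_k) * zn k + cabs ((pstar j)`_k - (pstar n)`_k) * zn k.
  rewrite -mulrDl ler_wpM2r ?(ltW (normzn_gt0 HX _))//.
  by apply: le_trans (cabsD _ _); rewrite addrA subrK.
rewrite exprS; rewrite -/j in IHd; lra.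
Qed.

Lemma pstar_coef_limit : exists b : nat -> C, forall q, 0 < q -> q <= 2^-1 ->
  exists N, forall n k, (N <= n)%N -> cabs (b k - (pstar n)`_k) * zn k <= 4 * q ^+ n.
Proof.
have h2 : 0 < 2^-1 :> R by rewrite invr_gt0.
have [N0 hN0] := pstar_coef_cauchy h2 (lexx _).
have /choice[b hb] : forall k, exists l, forall n, (N0 <= n)%N ->
    cabs (l - (pstar n)`_k) * zn k <= 8 / 2 ^+ n.
  move=> k; have z0 := normzn_gt0 HX k.
  have [|l hl] := @complex_limit _ (fun j => (pstar (j + N0))`_k)
     (fun j => 4 * 2^-1 ^+ (j + N0) / zn k).
    move=> n m nm; rewrite ler_pdivlMr//; apply: hN0; first exact: leq_addl.
    by rewrite leq_add2r.
  exists l => n Nn; have := hl (n - N0)%N; rewrite subnK// -ler_pdivlMr// => /le_trans.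
  apply; rewrite le_eqVlt; apply/orP; left; apply/eqP.
  by rewrite exprVn; ring.
(* The limit was constructed once, with ratio 1/2; letting m grow in the Cauchy estimate for q gives
   the rate q^n for the same limit. *)
exists b => q q0 q2; have [N hN] := pstar_coef_cauchy q0 q2.
exists N => n k Nn; apply/ler_addgt0Pr => e e0.
have [N1 hN1] := small_pow2 8 e0.
pose m := maxn (maxn n N0) N1.
have nm : (n <= m)%N by rewrite /m -maxnA leq_maxl.
have N0m : (N0 <= m)%N by rewrite /m maxnAC leq_maxr.
have N1m : (N1 <= m)%N by rewrite leq_maxr.
have s1 := hN n m k Nn nm; have s2 := le_trans (hb k m N0m) (hN1 m N1m).
apply: (@le_trans _ _ (cabs (b k - (pstar m)`_k) * zn k
    + cabs ((pstar m)`_k - (pstar n)`_k) * zn k)); last lra.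
rewrite -mulrDl ler_wpM2r ?(ltW (normzn_gt0 HX _))//.
by apply: le_trans (cabsD _ _); rewrite addrA subrK.
Qed.

Lemma entire_limit : exists F, [/\ entire F, eqD f F &
  forall r : R, 0 < r -> (r%:E < limn_einf (fun n : nat => (zn n `^ (n%:R^-1))%:E))%E ->
    forall eps : R, 0 < eps -> exists N, forall n, (N <= n)%N ->
      forall z : C, cabs z < r -> cabs ((pstar n).[z] - F z) < eps].
Proof.
have [b hb] := pstar_coef_limit.
have [m1 m10 [N1 h1]] := normzn_lower HX Hmu1.
have b_fast (r : R) : 0 < r -> exists M : R, forall k, cabs (b k) * r ^+ k <= M.
  (* Taken at n = k, where [pstar k] has no k-th coefficient, the limit estimate reads |b_k| [zn k]
     <= 4 q^k. As q r <= m1, multiplying by r^k leaves at most 4 m1^k <= 4 [zn k], and [zn k]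
     cancels. *)
  move=> r0; pose q := Num.min 2^-1 (m1 / r).
  have q0 : 0 < q by rewrite lt_min invr_gt0 ltr0n divr_gt0.
  have q2 : q <= 2^-1 by rewrite ge_min lexx.
  have qr : q * r <= m1 by rewrite -ler_pdivlMr// ge_min lexx orbT.
  have [N hN] := hb q q0 q2.
  apply: (@eventually_bounded _ (fun k => cabs (b k) * r ^+ k) 4 (maxn 1 (maxn N N1))) => k.
  rewrite !geq_max => /and3P[k1 kN kN1].
  have := hN k k kN; rewrite nth_default ?subr0; last by case: (pstarP k1).
  have z0 := normzn_gt0 HX k => hk.
  rewrite -(ler_pM2r z0) mulrAC.
  apply: (@le_trans _ _ (4 * q ^+ k * r ^+ k)).
    by rewrite ler_wpM2r// exprn_ge0// ltW.
  rewrite -mulrA -exprMn ler_wpM2l//; apply: le_trans (h1 k kN1).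
  by rewrite lerXn2r ?nnegrE ?(ltW m10)// mulr_ge0// ltW.
have [F [eF hF]] := power_series b_fast.
have cF : coef F =1 b.
  have [M hM] := b_fast (2 * 1) (mulr_gt0 (ltr0n _ 2) ltr01).
  apply: (@coef_unique _ F b (4 * M)) => // n z z1.
  by apply: (hF 1 M ltr01 hM); rewrite z1.
(* The estimate is summed over n coefficients; n <= 2^n reduces the rate 4^-n to 2^-n. *)
have q4 : 0 < 4^-1 :> R by rewrite invr_gt0.
have q42 : 4^-1 <= 2^-1 :> R by rewrite lef_pV2 ?posrE// ler_nat.
have [N2 h2] := hb _ q4 q42.
have n4 n : n%:R * (4 * 4^-1 ^+ n) <= 4 / 2 ^+ n :> R.
  have -> : (4^-1 : R) = 2^-1 * 2^-1 by rewrite -invfM -natrM.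
  rewrite exprMn mulrCA ler_pM2l// mulrA -[leRHS]mul1r exprVn.
  rewrite ler_wpM2r ?invr_ge0 ?exprn_ge0// ler_pdivrMr ?exprn_gt0// mul1r.
  by rewrite -natrX ler_nat ltnW// ltn_expl.
have hpsum n z : (1 <= n)%N -> (pstar n).[z] = psum (fun k => (pstar n)`_k) n z.
  by move=> n1; apply: horner_psum; case: (pstarP n1).
have psumB n z : (1 <= n)%N ->
    (pstar n).[z] - psum b n z = psum (fun k => (pstar n)`_k - b k) n z.
  move=> n1; rewrite hpsum// /psum -sumrB; apply: eq_bigr => k _.
  by rewrite mulrBl.
exists F; split => //.
- pose K := nrm (fun z => F (2 * z)).
  have FX := inX_entire HX eF.
  have [Nq hNq] := En_small (eqbRL (invr_gt0 _) (ltr0n R 2)).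
  have fFX := inXB HX fX FX.
  suff nf0 : nrm (fun z => f z - F z) = 0.
    move=> z Dz; have := nrm_eq0 HX fFX nf0 Dz => /eqP.
    by rewrite subr_eq0 => /eqP.
  apply/eqP; rewrite eq_le (nrm_ge0 HX fFX) andbT//.
  apply/ler_addgt0Pr => e e0; rewrite add0r.
  (* In norm, f is within 2^-n of [pstar n], which is within 4/2^n of the partial sum of [b], which
     is within 2K/2^n of F by [tail_norm]. *)
  have [N3 h3] := small_pow2 (1 + (4 + 2 * K)) e0.
  pose n := maxn (maxn Nq 1) (maxn N2 N3).
  have [n1 n2 n3 n5] : [/\ (Nq <= n)%N, (1 <= n)%N, (N2 <= n)%N & (N3 <= n)%N].
    by split; rewrite /n !leq_max leqnn ?orbT.
  apply: le_trans (h3 n n5); rewrite (mulrDl 1) (mulrDl 4).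
  apply: (le_trans (nrm_dist HX fX (inX_horner HX (pstar n)) FX)).
  rewrite lerD//.
    by rewrite (pstarP n2).2 mul1r -exprVn; exact: hNq.
  apply: (le_trans (nrm_dist HX (inX_horner HX (pstar n)) (inX_psum HX b n) FX)).
  rewrite lerD//; last first.
    rewrite (nrmBC HX (inX_psum HX b n) FX).
    have -> : (fun z => F z - psum b n z) = (fun z => F z - psum (coef F) n z).
      by apply/funext => z; congr (_ - _); apply: eq_bigr => k _; rewrite cF.
    by apply: (le_trans (tail_norm HX n eF)); rewrite mulrAC.
  have -> : (fun z => (pstar n).[z] - psum b n z) =
      (fun z => psum (fun k => (pstar n)`_k - b k) n z).
    by apply/funext => z; exact: psumB.
  apply: (le_trans (psum_norm HX _ n)).
  apply: (@le_trans _ _ (\sum_(k < n) 4 * 4^-1 ^+ n)).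
    by apply: ler_sum => k _; rewrite cabs_distC h2.
  by rewrite sumr_const card_ord -[leLHS]mulr_natl n4.
- move=> r r0 hr eps eps0.
  (* This is where r < mu_1 is used: r^k <= [zn k] for large k, so the weighted coefficient bounds
     control the polynomials uniformly on |z| < r. *)
  have [W hW] : exists W : R, forall k, r ^+ k / zn k <= W.
    have [N3 h3] := root_limit_lower (normzn_gt0 HX) r0 hr.
    apply: (@eventually_bounded _ _ 1 N3) => k kN.
    by rewrite ler_pdivrMr ?(normzn_gt0 HX)// mul1r h3.
  have W0 : 0 <= W.
    by apply: le_trans (hW 0%N); rewrite divr_ge0 ?exprn_ge0 ?ltW// (normzn_gt0 HX).
  have [M hM] := b_fast (2 * r) (mulr_gt0 (ltr0n _ 2) r0).
  have e2 : 0 < eps / 2 by rewrite divr_gt0.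
  have [N3 h3] := small_pow2 (4 * W + 4 * M) e2.
  exists (maxn 1 (maxn N2 N3)) => n; rewrite !geq_max => /and3P[n1 n2 n3] z zr.
  apply: (@le_lt_trans _ _ (eps / 2)); last lra.
  apply: le_trans (h3 n n3).
  rewrite -(subrK (psum b n z) (pstar n).[z]) -addrA (le_trans (cabsD _ _))//.
  rewrite (mulrDl (4 * W)) lerD//; last first.
    by rewrite cabs_distC; apply: (hF r M r0 hM); exact: ltW.
  rewrite psumB//; apply: (le_trans (cabs_sum _ _ _)).
  apply: (@le_trans _ _ (\sum_(k < n) (4 * 4^-1 ^+ n) * W)).
    apply: ler_sum => k _; have z0 := normzn_gt0 HX k.
    apply: (@le_trans _ _ (4 * 4^-1 ^+ n * (r ^+ k / zn k))); last first.
      by rewrite ler_wpM2l ?hW// mulr_ge0// exprn_ge0// ltW.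
    rewrite cabsM cabsX mulrA ler_pdivlMr// mulrAC.
    rewrite ler_pM ?mulr_ge0 ?exprn_ge0 ?cabs_ge0 ?(ltW z0)//.
      by rewrite cabs_distC h2.
    by rewrite lerXn2r ?nnegrE ?cabs_ge0// ltW.
  have -> : 4 * W / 2 ^+ n = 4 / 2 ^+ n * W by rewrite mulrAC.
  by rewrite sumr_const card_ord -[leLHS]mulr_natl [leLHS]mulrA ler_wpM2r.
Qed.

End Converse.

Theorem theorem4p2 (R : realType) (inX : set (R[i] -> R[i])) (nrm : (R[i] -> R[i]) -> R)
  (HX : fun_Banach_space inX nrm)
  (Hmu1 : (0 < limn_einf (fun n : nat => (normzn nrm n `^ (n%:R^-1))%:E))%E)
  (Hmu2 : (limn_esup (fun n : nat => (normzn nrm n `^ (n%:R^-1))%:E) < +oo)%E)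
  (f : R[i] -> R[i]) (Hf : inX f) :
  (forall (rho : R), 0 < rho ->
     (exists F : R[i] -> R[i], entire F /\ eqD f F /\ entire_order F = rho%:E) ->
     limn_esup (fun n : nat =>
       ((n%:R * ln n%:R) / ln (normzn nrm n / En nrm f n))%:E) = rho%:E)
  /\
  (forall (rho : R), 0 < rho ->
     limn_esup (fun n : nat =>
       ((n%:R * ln n%:R) / ln (normzn nrm n / En nrm f n))%:E) = rho%:E ->
     forall pstar : nat -> {poly R[i]},
       (forall n : nat, (1 <= n)%N ->
          (size (pstar n) <= n)%N /\
          nrm (fun z => f z - (pstar n).[z]) = En nrm f n) ->
       exists F : R[i] -> R[i], entire F /\ entire_order F = rho%:E /\
         (forall r : R, 0 < r ->
            (r%:E < limn_einf (fun n : nat => (normzn nrm n `^ (n%:R^-1))%:E))%E ->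
            forall eps : R, 0 < eps -> exists N : nat, forall n : nat, (N <= n)%N ->
              forall z : R[i], cabs z < r -> cabs ((pstar n).[z] - F z) < eps)).
Proof.
split=> [rho rho0 [F [eF [fF oF]]]|rho rho0 rateE pstar pstarP].
  exact: (entire_order_rate HX Hmu1 Hmu2 Hf rho0 eF fF oF).
have [F [eF fF cvgF]] := entire_limit HX Hmu1 Hmu2 Hf rho0 rateE pstarP.
exists F; split => //; split => //.
apply: (rate_entire_order HX Hmu1 Hmu2 Hf rho0 eF fF _ rateE).
exact: (En_eventually_lt HX Hmu1 Hmu2 Hf rho0 rateE).
Qed.
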